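(* Assume the Framework and the Purification Postulate. Let $\rho\in\mathfrak S_1(\mathrm A)$ and let $\mathcal C\in\mathfrak T(\mathrm A,\mathrm B)$ be a channel. Then $\mathcal C$ is correctable upon input of $\rho$ if and only if there exist a reversible dilation $\mathcal V\in\mathfrak T(\mathrm A,\mathrm B\mathrm E)$ of $\mathcal C$, a purification $\Psi_\rho\in\mathfrak S_1(\mathrm A\mathrm R)$ of $\rho$, and a state $\sigma\in\mathfrak S_1(\mathrm E)$ such that $(e_{\mathrm B}\otimes\mathcal I_{\mathrm E}\otimes\mathcal I_{\mathrm R})(\mathcal V\otimes\mathcal I_{\mathrm R})\Psi_\rho=\sigma\otimes\tilde\rho$, where $\tilde\rho:=(e_{\mathrm A}\otimes\mathcal I_{\mathrm R})\Psi_\rho$.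
   Context: Framework. We work in an operational-probabilistic theory: there is a collection of systems $\mathrm A,\mathrm B,\dots$, closed under a composition $\mathrm A\mathrm B$ (associative, symmetric up to a reversible swap, with a trivial system $\mathrm I$ satisfying $\mathrm A\mathrm I=\mathrm A$); for each pair of systems a set $\mathfrak T(\mathrm A,\mathrm B)$ of transformations; a test from $\mathrm A$ to $\mathrm B$ is a finite collection $\{\mathcal C_i\}_{i\in X}\subseteq\mathfrak T(\mathrm A,\mathrm B)$, and every transformation belongs to some test. Tests are closed under sequential composition, parallel composition ($\otimes$), coarse-graining (summing outcomes over the blocks of a partition of $X$) and conditioning (choosing the next test depending on the outcome of the previous one). States of $\mathrm A$ are the elements of $\mathfrak S(\mathrm A):=\mathfrak T(\mathrm I,\mathrm A)$, effects are the elements of $\mathfrak T(\mathrm A,\mathrm I)$, and transformations $\mathrm I\to\mathrm I$ are probabilities in $[0,1]$ (those of a test sum to $1$; composition is multiplication). An effect $a$ and a state $\rho$ give the probability $(a|\rho)$. States (effects) are identified when they give equal probabilities on all effects (states); transformations $\mathcal C,\mathcal C'$ are identified when $\mathcal C\otimes\mathcal I_{\mathrm S}$ and $\mathcal C'\otimes\mathcal I_{\mathrm S}$ act identically on all states of $\mathrm A\mathrm S$ for every system $\mathrm S$. States span a finite-dimensional real vector space $\mathfrak S_{\mathbb R}(\mathrm A)$, transformations act linearly, and $\mathfrak T_{\mathbb R}(\mathrm A,\mathrm B)$ is the real span of $\mathfrak T(\mathrm A,\mathrm B)$. Standing assumptions: (i) causality: each system $\mathrm A$ has a unique deterministic effect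 $e_{\mathrm A}$ (the effect forming a one-outcome observation test), and $e_{\mathrm A\mathrm B}=e_{\mathrm A}\otimes e_{\mathrm B}$; (ii) local discriminability: if two states of $\mathrm A\mathrm B$ differ, some product effect $a\otimes b$ gives them different probabilities; (iii) all sets of states are closed, the theory is not deterministic (hence all sets of states, effects and transformations are convex), and perfectly distinguishable states exist. A state $\rho$ is normalized if $(e|\rho)=1$; $\mathfrak S_1(\mathrm A)$ is the set of normalized states. A channel is a $\mathcal C\in\mathfrak T(\mathrm A,\mathrm B)$ with $e_{\mathrm B}\circ\mathcal C=e_{\mathrm A}$. A channel $\mathcal U\in\mathfrak T(\mathrm A,\mathrm B)$ is reversible if some channel $\mathcal W\in\mathfrak T(\mathrm B,\mathrm A)$ satisfies $\mathcal W\mathcal U=\mathcal I_{\mathrm A}$, $\mathcal U\mathcal W=\mathcal I_{\mathrm B}$; $\mathbf G_{\mathrm A}$ is the group of reversible channels on $\mathrm A$. The marginal of a state $\sigma$ of $\mathrm A\mathrm B$ on $\mathrm A$ is $(\mathcal I_{\mathrm A}\otimes e_{\mathrm B})\sigma$. Refinement. For $\mathcal C\in\mathfrak T(\mathrm A,\mathrm B)$, write $\mathcal D\prec\mathcal C$ if there are a test $\{\mathcal D_j\}_{j\in Y}$ and $Y_0\subseteq Y$ with $\mathcal C=\sum_{j\in Y_0}\mathcal D_j$ and $\mathcal D\in\{\mathcal D_j\}_{j\in Y_0}$; the refinement set is $D_{\mathcal C}=\{\mathcal D:\mathcal D\prec\mathcal C\}$. $\mathcal C$ is atomic if $\mathcal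 D\prec\mathcal C$ implies $\mathcal D=\lambda\mathcal C$ for some $\lambda\in[0,1]$. A pure state is an atomic state; a state is mixed otherwise. Purification Postulate. For every $\rho\in\mathfrak S_1(\mathrm A)$ there are a system $\mathrm B$ and a pure $\Psi\in\mathfrak S_1(\mathrm A\mathrm B)$ with $(\mathcal I_{\mathrm A}\otimes e_{\mathrm B})\Psi=\rho$ (a purification of $\rho$, with purifying system $\mathrm B$); and if $\Psi,\Psi'\in\mathfrak S_1(\mathrm A\mathrm B)$ are purifications of the same state, then $\Psi'=(\mathcal I_{\mathrm A}\otimes\mathcal U)\Psi$ for some $\mathcal U\in\mathbf G_{\mathrm B}$. A reversible dilation of $\mathcal C\in\mathfrak T(\mathrm A,\mathrm B)$ is a channel $\mathcal V\in\mathfrak T(\mathrm A,\mathrm B\mathrm E)$ with $(\mathcal I_{\mathrm B}\otimes e_{\mathrm E})\mathcal V=\mathcal C$ that is of the form $\mathcal V=\mathcal U(\mathcal I_{\mathrm A}\otimes\varphi_0)$ for a pure state $\varphi_0$ of some system $\mathrm E_0$ and a reversible channel $\mathcal U\in\mathfrak T(\mathrm A\mathrm E_0,\mathrm B\mathrm E)$. A channel $\mathcal C\in\mathfrak T(\mathrm A,\mathrm B)$ is correctable upon input of $\rho$ if there is a channel $\mathcal R\in\mathfrak T(\mathrm B,\mathrm A)$ with $\mathcal R\mathcal C\sigma=\sigma$ for all $\sigma\in D_\rho$. *)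

(* Defs.v *)
From Stdlib Require Import Reals List Permutation.
Import ListNotations.
Open Scope R_scope.
Set Implicit Arguments.
Unset Strict Implicit.

(*  - systems with a composition [sc] and trivial system [triv];       *)
(*    associativity and unit laws are strict (Leibniz) equalities, so  *)
(*    re-bracketing is done by the transports [castS]/[castT] below.   *)
(*  - [Tr A B] is the real span T_R(A,B); [phys] carves out the set    *)
(*    T(A,B) of (physical) transformations.  Identification of         *)
(*    transformations is Leibniz equality on [Tr A B] (axioms of       *)
(*    separation below make this the paper's identification).         *)
(*  - states of A are Tr triv A, effects Tr A triv, [prob] identifies   *)
(*    Tr triv triv with the reals.                                     *)
Record OPTdata : Type := {
  Sys : Type;
  triv : Sys;
  sc : Sys -> Sys -> Sys;
  sc_assoc : forall A B C, sc A (sc B C) = sc (sc A B) C;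
  sc_unitr : forall A, sc A triv = A;
  sc_unitl : forall A, sc triv A = A;
  Tr : Sys -> Sys -> Type;
  tzero : forall A B, Tr A B;
  tadd : forall A B, Tr A B -> Tr A B -> Tr A B;
  tscal : forall A B, R -> Tr A B -> Tr A B;
  phys : forall A B, Tr A B -> Prop;
  tcomp : forall A B C, Tr B C -> Tr A B -> Tr A C;
  tid : forall A, Tr A A;
  ttens : forall A B C D, Tr A B -> Tr C D -> Tr (sc A C) (sc B D);
  swap : forall A B, Tr (sc A B) (sc B A);
  isTest : forall A B, list (Tr A B) -> Prop;
  prob : Tr triv triv -> R;
  deff : forall A, Tr A triv
}.

Arguments triv {_}.
Arguments sc {_} _ _.
Arguments Tr {_} _ _.
Arguments tzero {_} A B.
Arguments tadd {_ A B} _ _.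
Arguments tscal {_ A B} _ _.
Arguments phys {_ A B} _.
Arguments tcomp {_ A B C} _ _.
Arguments tid {_} A.
Arguments ttens {_ A B C D} _ _.
Arguments swap {_} A B.
Arguments isTest {_ A B} _.
Arguments prob {_} _.
Arguments deff {_} A.
Arguments sc_assoc {_} A B C.
Arguments sc_unitr {_} A.
Arguments sc_unitl {_} A.

Definition castT (T : OPTdata) (A B B' : Sys T) (e : B = B') (f : Tr A B)
  : Tr A B' := eq_rect B (Tr A) f B' e.
Definition castS (T : OPTdata) (A A' B : Sys T) (e : A = A') (f : Tr A B)
  : Tr A' B := eq_rect A (fun X => Tr X B) f A' e.

Definition tsum (T : OPTdata) (A B : Sys T) (l : list (Tr A B)) : Tr A B :=
  fold_right (@tadd T A B) (tzero A B) l.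

Definition in_span (T : OPTdata) (A B : Sys T) (l : list (Tr A B)) (f : Tr A B)
  : Prop :=
  exists cs : list R, length cs = length l /\
    f = tsum (map (fun p => tscal (fst p) (snd p)) (combine cs l)).

Definition normalized (T : OPTdata) (A : Sys T) (rho : Tr triv A) : Prop :=
  phys rho /\ prob (tcomp (deff A) rho) = 1.

Definition prod_eff (T : OPTdata) (A B : Sys T) (a : Tr A triv) (b : Tr B triv)
  : Tr (sc A B) triv := castT (sc_unitl triv) (ttens a b).

Record OPTaxioms (T : OPTdata) : Prop := {
  add_comm : forall (A B : Sys T) (f g : Tr A B), tadd f g = tadd g f;
  add_assoc : forall (A B : Sys T) (f g h : Tr A B), tadd f (tadd g h) = tadd (tadd f g) h;
  add_zero : forall (A B : Sys T) (f : Tr A B), tadd f (tzero A B) = f;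
  add_opp : forall (A B : Sys T) (f : Tr A B), tadd f (tscal (-1) f) = tzero A B;
  scal_one : forall (A B : Sys T) (f : Tr A B), tscal 1 f = f;
  scal_mul : forall (A B : Sys T) a b (f : Tr A B), tscal a (tscal b f) = tscal (a * b) f;
  scal_addR : forall (A B : Sys T) a b (f : Tr A B), tscal (a + b) f = tadd (tscal a f) (tscal b f);
  scal_addT : forall (A B : Sys T) a (f g : Tr A B), tscal a (tadd f g) = tadd (tscal a f) (tscal a g);
  span_phys : forall (A B : Sys T) (f : Tr A B), exists l, Forall (@phys T A B) l /\ in_span l f;
  fin_dim_states : forall (A : Sys T), exists basis : list (Tr triv A),
      forall rho, in_span basis rho;
  comp_assoc : forall (A B C D : Sys T) (f : Tr C D) (g : Tr B C) (h : Tr A B),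
      tcomp f (tcomp g h) = tcomp (tcomp f g) h;
  comp_idl : forall (A B : Sys T) (f : Tr A B), tcomp (tid B) f = f;
  comp_idr : forall (A B : Sys T) (f : Tr A B), tcomp f (tid A) = f;
  comp_addl : forall (A B C : Sys T) (f g : Tr B C) (h : Tr A B),
      tcomp (tadd f g) h = tadd (tcomp f h) (tcomp g h);
  comp_addr : forall (A B C : Sys T) (f : Tr B C) (g h : Tr A B),
      tcomp f (tadd g h) = tadd (tcomp f g) (tcomp f h);
  comp_scall : forall (A B C : Sys T) a (f : Tr B C) (h : Tr A B),
      tcomp (tscal a f) h = tscal a (tcomp f h);
  comp_scalr : forall (A B C : Sys T) a (f : Tr B C) (h : Tr A B),
      tcomp f (tscal a h) = tscal a (tcomp f h);
  tens_addl : forall (A B C D : Sys T) (f g : Tr A B) (h : Tr C D),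
      ttens (tadd f g) h = tadd (ttens f h) (ttens g h);
  tens_addr : forall (A B C D : Sys T) (f : Tr A B) (g h : Tr C D),
      ttens f (tadd g h) = tadd (ttens f g) (ttens f h);
  tens_scall : forall (A B C D : Sys T) a (f : Tr A B) (h : Tr C D),
      ttens (tscal a f) h = tscal a (ttens f h);
  tens_scalr : forall (A B C D : Sys T) a (f : Tr A B) (h : Tr C D),
      ttens f (tscal a h) = tscal a (ttens f h);
  tens_comp : forall (A B C A' B' C' : Sys T) (f : Tr B C) (g : Tr A B)
      (f' : Tr B' C') (g' : Tr A' B'),
      tcomp (ttens f f') (ttens g g') = ttens (tcomp f g) (tcomp f' g');
  tens_id : forall (A B : Sys T), ttens (tid A) (tid B) = tid (sc A B);
  tens_assoc : forall (A B C D E F : Sys T) (f : Tr A B) (g : Tr C D) (h : Tr E F),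
      ttens f (ttens g h) =
      castS (eq_sym (sc_assoc A C E)) (castT (eq_sym (sc_assoc B D F))
        (ttens (ttens f g) h));
  tens_unitr : forall (A B : Sys T) (f : Tr A B),
      castS (sc_unitr A) (castT (sc_unitr B) (ttens f (tid triv))) = f;
  tens_unitl : forall (A B : Sys T) (f : Tr A B),
      castS (sc_unitl A) (castT (sc_unitl B) (ttens (tid triv) f)) = f;
  swap_test : forall (A B : Sys T), isTest [swap A B];
  swap_invol : forall (A B : Sys T), tcomp (swap B A) (swap A B) = tid (sc A B);
  swap_nat : forall (A B C D : Sys T) (f : Tr A B) (g : Tr C D),
      tcomp (swap B D) (ttens f g) = tcomp (ttens g f) (swap A C);
  swap_hexagon : forall (A B C : Sys T),
      swap A (sc B C) =
      tcomp (castT (sc_assoc B C A) (ttens (tid B) (swap A C)))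
        (castS (eq_sym (sc_assoc A B C))
          (castT (eq_sym (sc_assoc B A C)) (ttens (swap A B) (tid C))));
  prob_add : forall p q : Tr (@triv T) (@triv T), prob (tadd p q) = prob p + prob q;
  prob_scal : forall a (p : Tr (@triv T) (@triv T)), prob (tscal a p) = a * prob p;
  prob_id : prob (tid (@triv T)) = 1;
  prob_inj : forall p q : Tr (@triv T) (@triv T), prob p = prob q -> p = q;
  prob_comp : forall p q : Tr (@triv T) (@triv T), prob (tcomp p q) = prob p * prob q;
  prob_tens : forall p q : Tr (@triv T) (@triv T),
      prob (castS (sc_unitl triv) (castT (sc_unitl triv) (ttens p q)))
      = prob p * prob q;
  phys_prob : forall p : Tr (@triv T) (@triv T), phys p -> 0 <= prob p <= 1;
  test_prob : forall l : list (Tr (@triv T) (@triv T)),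
      isTest l -> fold_right Rplus 0 (map prob l) = 1;
  state_sep : forall (A : Sys T) (rho rho' : Tr triv A),
      (forall a : Tr A triv, phys a -> prob (tcomp a rho) = prob (tcomp a rho')) ->
      rho = rho';
  effect_sep : forall (A : Sys T) (a a' : Tr A triv),
      (forall rho : Tr triv A, phys rho -> prob (tcomp a rho) = prob (tcomp a' rho)) ->
      a = a';
  transf_sep : forall (A B : Sys T) (f g : Tr A B),
      (forall (S : Sys T) (rho : Tr triv (sc A S)), phys rho ->
         tcomp (ttens f (tid S)) rho = tcomp (ttens g (tid S)) rho) ->
      f = g;
  test_phys : forall (A B : Sys T) (l : list (Tr A B)), isTest l -> Forall (@phys T A B) l;
  phys_test : forall (A B : Sys T) (f : Tr A B), phys f -> exists l, isTest l /\ In f l;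
  test_id : forall (A : Sys T), isTest [tid A];
  test_perm : forall (A B : Sys T) (l l' : list (Tr A B)), isTest l -> Permutation l l' -> isTest l';
  test_seq : forall (A B C : Sys T) (l1 : list (Tr A B)) (l2 : list (Tr B C)),
      isTest l1 -> isTest l2 ->
      isTest (flat_map (fun c => map (fun d => tcomp d c) l2) l1);
  test_par : forall (A B C D : Sys T) (l1 : list (Tr A B)) (l2 : list (Tr C D)),
      isTest l1 -> isTest l2 ->
      isTest (flat_map (fun c => map (fun d => ttens c d) l2) l1);
  test_cond : forall (A B C : Sys T) (l1 : list (Tr A B)) (L : nat -> list (Tr B C)),
      isTest l1 -> (forall i, (i < length l1)%nat -> isTest (L i)) ->
      isTest (flat_map (fun i => map (fun d => tcomp d (nth i l1 (tzero A B))) (L i))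
                (seq 0 (length l1)));
  test_coarse : forall (A B : Sys T) (l : list (Tr A B)) (m : nat) (g : nat -> nat),
      isTest l ->
      (forall i, (i < length l)%nat -> (g i < m)%nat) ->
      (forall k, (k < m)%nat -> exists i, (i < length l)%nat /\ g i = k) ->
      isTest (map (fun k => tsum (map snd (filter (fun p => Nat.eqb (g (fst p)) k)
                                          (combine (seq 0 (length l)) l))))
                  (seq 0 m));
  deff_test : forall (A : Sys T), isTest [deff A];
  deff_unique : forall (A : Sys T) (e : Tr A triv), isTest [e] -> e = deff A;
  deff_tens : forall (A B : Sys T), deff (sc A B) = prod_eff (deff A) (deff B);
  loc_disc : forall (A B : Sys T) (rho rho' : Tr triv (sc A B)), phys rho -> phys rho' ->
      (forall (a : Tr A triv) (b : Tr B triv), phys a -> phys b ->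
         prob (tcomp (prod_eff a b) rho) = prob (tcomp (prod_eff a b) rho')) ->
      rho = rho';
  (* (iii) closedness of state sets (convergence of all outcome
     probabilities = convergence in the finite-dim. state space),
     non-determinism, existence of perfectly distinguishable states *)
  states_closed : forall (A : Sys T) (s : nat -> Tr triv A) (rho : Tr triv A),
      (forall n, phys (s n)) ->
      (forall a : Tr A triv, phys a ->
         Un_cv (fun n => prob (tcomp a (s n))) (prob (tcomp a rho))) ->
      phys rho;
  non_det : exists p : Tr (@triv T) (@triv T), phys p /\ 0 < prob p < 1;
  perf_dist : exists (A : Sys T) (rho0 rho1 : Tr triv A) (a0 a1 : Tr A triv),
      normalized rho0 /\ normalized rho1 /\ isTest [a0; a1] /\
      prob (tcomp a0 rho0) = 1 /\ prob (tcomp a1 rho0) = 0 /\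
      prob (tcomp a0 rho1) = 0 /\ prob (tcomp a1 rho1) = 1
}.

Definition refines (T : OPTdata) (A B : Sys T) (D C : Tr A B) : Prop :=
  exists (l l0 l1 : list (Tr A B)),
    isTest l /\ Permutation l (l0 ++ l1) /\ C = tsum l0 /\ In D l0.

Definition atomic (T : OPTdata) (A B : Sys T) (C : Tr A B) : Prop :=
  forall D, refines D C -> exists lam : R, 0 <= lam <= 1 /\ D = tscal lam C.

Definition pure (T : OPTdata) (A : Sys T) (rho : Tr triv A) : Prop :=
  phys rho /\ atomic rho.

Definition channel (T : OPTdata) (A B : Sys T) (C : Tr A B) : Prop :=
  phys C /\ tcomp (deff B) C = deff A.

Definition reversible (T : OPTdata) (A B : Sys T) (U : Tr A B) : Prop :=
  channel U /\ exists W : Tr B A, channel W /\ tcomp W U = tid A /\ tcomp U W = tid B.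

Definition marg1 (T : OPTdata) (A R : Sys T) (Psi : Tr triv (sc A R)) : Tr triv A :=
  castT (sc_unitr A) (tcomp (ttens (tid A) (deff R)) Psi).

Definition marg2 (T : OPTdata) (A R : Sys T) (Psi : Tr triv (sc A R)) : Tr triv R :=
  castT (sc_unitl R) (tcomp (ttens (deff A) (tid R)) Psi).

Definition purification (T : OPTdata) (A R : Sys T) (rho : Tr triv A)
    (Psi : Tr triv (sc A R)) : Prop :=
  pure Psi /\ normalized Psi /\ marg1 Psi = rho.

Definition PurificationPostulate (T : OPTdata) : Prop :=
  (forall (A : Sys T) (rho : Tr triv A), normalized rho ->
     exists (B : Sys T) (Psi : Tr triv (sc A B)), purification rho Psi) /\
  (forall (A B : Sys T) (rho : Tr triv A) (Psi Psi' : Tr triv (sc A B)),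
     purification rho Psi -> purification rho Psi' ->
     exists U : Tr B B, reversible U /\ Psi' = tcomp (ttens (tid A) U) Psi).

Definition rev_dilation (T : OPTdata) (A B E : Sys T) (C : Tr A B)
    (V : Tr A (sc B E)) : Prop :=
  channel V /\
  castT (sc_unitr B) (tcomp (ttens (tid B) (deff E)) V) = C /\
  exists (E0 : Sys T) (phi0 : Tr triv E0) (U : Tr (sc A E0) (sc B E)),
    pure phi0 /\ reversible U /\
    V = tcomp U (castS (sc_unitr A) (ttens (tid A) phi0)).

Definition correctable (T : OPTdata) (A B : Sys T) (C : Tr A B) (rho : Tr triv A)
  : Prop :=
  exists Rc : Tr B A, channel Rc /\
    forall sigma, refines sigma rho -> tcomp Rc (tcomp C sigma) = sigma.

(* Main.v *)
(** The idea: [C] recovers every refinement of [rho] exactly when some channel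
    undoes [C] on a purification [Psi] of [rho], because steering reaches all of the
    refinement set from [Psi]. If [R C] fixes [Psi], then applying [R] to the dilated
    state leaves the pure marginal [Psi], hence a product state, and discarding the
    system gives the uncorrelated environment and reference. Conversely, if environment
    and reference are uncorrelated, the dilated state and [Psi] tensored with a
    purification of [sigma] purify the same state, so a channel on the output of [C]
    maps one to the other.

    The postulate relates purifications with the same purifying system only, and
    pure states of an arbitrary system are not available; both obstacles are met by
    letting two purifications of one state serve as ancillas for each other. *)

Require Import Defs.
From Stdlib Require Import Reals List Permutation Lra Lia Eqdep ClassicalEpsilon.
Import ListNotations.
Open Scope R_scope.
Set Implicit Arguments.
Unset Strict Implicit.

(* Morphisms bundled with their end points: Leibniz equality of bundles ignores the
   transports [castS] and [castT], so the tensor product is strictly associative. *)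
Record Mor (T : OPTdata) := mk { dom : Sys T; cod : Sys T; arr : Tr dom cod }.
Arguments mk {T dom cod} arr.

(** Whether the end points match is decided classically, so composition is total and untyped
    rewriting applies; the default for a mismatch is zero because zero is absorbing. *)
Definition mcomp (T : OPTdata) (g f : Mor T) : Mor T :=
  match excluded_middle_informative (cod f = dom g) with
  | left e => mk (tcomp (arr g) (castT e (arr f)))
  | right _ => mk (tzero (dom f) (cod g))
  end.
Definition mtens (T : OPTdata) (f g : Mor T) : Mor T := mk (ttens (arr f) (arr g)).
Definition mid (T : OPTdata) (A : Sys T) : Mor T := mk (tid A).

Declare Scope mor_scope.
Infix "@o" := mcomp (at level 41, right associativity) : mor_scope.
Infix "@x" := mtens (at level 39, left associativity) : mor_scope.
Local Open Scope mor_scope.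

(** The way back from untyped to typed equations. The right-hand bundle is generalized together with
    equations for its end points; once it is [mk f], these are loops, removed by uniqueness of
    identity proofs. *)
Lemma mk_inj (T : OPTdata) (A B : Sys T) (f g : Tr A B) : mk f = mk g -> f = g.
Proof.
  pose (get := fun (m : Mor T) (e1 : dom m = A) (e2 : cod m = B) =>
    castS e1 (castT e2 (arr m))).
  enough (K : forall m e1 e2, mk f = m -> f = get m e1 e2).
  { intros H. exact (K (mk g) eq_refl eq_refl H). }
  intros m e1 e2 <-. unfold get; cbn in *.
  rewrite (UIP_refl _ _ e1), (UIP_refl _ _ e2). reflexivity.
Qed.

Lemma mk_castT (T : OPTdata) (A B B' : Sys T) (e : B = B') (f : Tr A B) :
  mk (castT e f) = mk f.
Proof. destruct e; reflexivity. Qed.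

Lemma mk_castS (T : OPTdata) (A A' B : Sys T) (e : A = A') (f : Tr A B) :
  mk (castS e f) = mk f.
Proof. destruct e; reflexivity. Qed.

Lemma mk_comp (T : OPTdata) (A B C : Sys T) (g : Tr B C) (f : Tr A B) :
  mk (tcomp g f) = mk g @o mk f.
Proof.
  unfold mcomp; cbn. destruct excluded_middle_informative as [e|n].
  - rewrite (UIP_refl _ _ e). reflexivity.
  - now destruct n.
Qed.

Lemma mk_tens (T : OPTdata) (A B C D : Sys T) (f : Tr A B) (g : Tr C D) :
  mk (ttens f g) = mk f @x mk g.
Proof. reflexivity. Qed.

Lemma mk_id (T : OPTdata) (A : Sys T) : mk (tid A) = mid A.
Proof. reflexivity. Qed.

Lemma dom_comp (T : OPTdata) (g f : Mor T) : dom (g @o f) = dom f.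
Proof. unfold mcomp. now destruct excluded_middle_informative. Qed.

Lemma cod_comp (T : OPTdata) (g f : Mor T) : cod (g @o f) = cod g.
Proof. unfold mcomp. now destruct excluded_middle_informative. Qed.

Lemma dom_tens (T : OPTdata) (f g : Mor T) : dom (f @x g) = sc (dom f) (dom g).
Proof. reflexivity. Qed.

Lemma cod_tens (T : OPTdata) (f g : Mor T) : cod (f @x g) = sc (cod f) (cod g).
Proof. reflexivity. Qed.

Lemma mcomp_bad (T : OPTdata) (g f : Mor T) :
  cod f <> dom g -> g @o f = mk (tzero (dom f) (cod g)).
Proof. intros n. unfold mcomp. now destruct excluded_middle_informative. Qed.

Section Theory.

Context (T : OPTdata) (HT : OPTaxioms T).

(** * Strict symmetric monoidal laws for bundled morphisms *)

Lemma scal_zero (A B : Sys T) (f : Tr A B) :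
  tscal 0 f = tzero A B.
Proof.
  rewrite <- (add_opp HT f). rewrite <- (scal_one HT f) at 2.
  rewrite <- (scal_addR HT). f_equal. lra.
Qed.

Lemma comp_zerol (A B C : Sys T) (f : Tr A B) :
  tcomp (tzero B C) f = tzero A C.
Proof.
  rewrite <- (scal_zero (tzero B C)), (comp_scall HT). exact (scal_zero _).
Qed.

Lemma comp_zeror (A B C : Sys T) (f : Tr B C) :
  tcomp f (tzero A B) = tzero A C.
Proof.
  rewrite <- (scal_zero (tzero A B)), (comp_scalr HT). exact (scal_zero _).
Qed.

(* Composition of ill-typed pairs is zero, so associativity holds unconditionally. *)
Lemma mcompA (h g f : Mor T) :
  h @o (g @o f) = (h @o g) @o f.
Proof.
  destruct (classic (cod f = dom g)) as [e1|n1];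
  destruct (classic (cod g = dom h)) as [e2|n2];
  destruct f as [A B f], g as [B' C g], h as [C' D h]; cbn in *; subst.
  - rewrite <- !mk_comp. now rewrite (comp_assoc HT).
  - rewrite <- mk_comp, (mcomp_bad (g := mk h) (f := mk g)) by exact n2.
    rewrite mcomp_bad by exact n2. cbn. now rewrite <- mk_comp, comp_zerol.
  - rewrite <- mk_comp, (mcomp_bad (g := mk g)) by exact n1.
    rewrite (mcomp_bad (g := mk (tcomp h g))) by exact n1. cbn. now rewrite <- mk_comp, comp_zeror.
  - rewrite (mcomp_bad (g := mk g)), (mcomp_bad (g := mk h) (f := mk g)),
      (mcomp_bad (g := mk h)), mcomp_bad by assumption.
    reflexivity.
Qed.

Lemma mcomp1l (A : Sys T) (f : Mor T) :
  cod f = A -> mid A @o f = f.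
Proof.
  destruct f as [B C f]; cbn; intros <-. unfold mid.
  now rewrite <- mk_comp, (comp_idl HT).
Qed.

Lemma mcomp1r (A : Sys T) (f : Mor T) :
  dom f = A -> f @o mid A = f.
Proof.
  destruct f as [B C f]; cbn; intros <-. unfold mid.
  now rewrite <- mk_comp, (comp_idr HT).
Qed.

Lemma mtensC (f g f' g' : Mor T) :
  cod g = dom f -> cod g' = dom f' ->
  (f @x f') @o (g @x g') = (f @o g) @x (f' @o g').
Proof.
  destruct f as [B C f], g as [A B1 g], f' as [B' C' f'], g' as [A' B1' g'].
  cbn; intros -> ->. rewrite <- !mk_comp, <- !mk_tens, <- mk_comp.
  now rewrite (tens_comp HT).
Qed.

Lemma mtensA (f g h : Mor T) :
  f @x (g @x h) = f @x g @x h.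
Proof.
  destruct f as [A B f], g as [C D g], h as [E F h].
  rewrite <- !mk_tens, (tens_assoc HT). now rewrite mk_castS, mk_castT.
Qed.

Lemma mtens1l (f : Mor T) : mid triv @x f = f.
Proof.
  destruct f as [A B f]. rewrite <- (tens_unitl HT f) at 2.
  now rewrite mk_castS, mk_castT.
Qed.

Lemma mtens1r (f : Mor T) : f @x mid triv = f.
Proof.
  destruct f as [A B f]. rewrite <- (tens_unitr HT f) at 2.
  now rewrite mk_castS, mk_castT.
Qed.

Lemma mtens11 (A B : Sys T) :
  mid A @x mid B = mid (sc A B).
Proof. unfold mid. rewrite <- mk_tens. now rewrite (tens_id HT). Qed.

(** Discharges matching conditions on end points: trivial factors are dropped and brackets moved to
    the left. *)
Ltac obj := repeat (progress (rewrite ?dom_comp, ?cod_comp, ?dom_tens, ?cod_tens; cbn [dom cod mid]));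
  repeat (progress (rewrite ?sc_unitl, ?sc_unitr, ?sc_assoc)); reflexivity.

Lemma mtens_slide (f g : Mor T) (A B : Sys T) :
  dom f = A -> cod g = B -> (f @x mid B) @o (mid A @x g) = f @x g.
Proof. intros <- <-. rewrite mtensC by obj. now rewrite mcomp1l, mcomp1r. Qed.

Lemma mtens_slide' (f g : Mor T) (A B : Sys T) :
  cod f = A -> dom g = B -> (mid A @x g) @o (f @x mid B) = f @x g.
Proof. intros <- <-. rewrite mtensC by obj. now rewrite mcomp1l, mcomp1r. Qed.

Definition mswap (A B : Sys T) : Mor T := mk (swap A B).

Lemma mswapK (A B : Sys T) :
  mswap B A @o mswap A B = mid (sc A B).
Proof. unfold mswap, mid. now rewrite <- mk_comp, (swap_invol HT). Qed.

Lemma mswap_nat (f g : Mor T) (A B C D : Sys T) :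
  dom f = A -> cod f = B -> dom g = C -> cod g = D ->
  mswap B D @o (f @x g) = (g @x f) @o mswap A C.
Proof.
  destruct f, g; cbn; intros; subst. unfold mswap.
  rewrite <- !mk_tens, <- !mk_comp. now rewrite (swap_nat HT).
Qed.

Lemma mswap_hex (A B C : Sys T) :
  mswap A (sc B C) = (mid B @x mswap A C) @o (mswap A B @x mid C).
Proof.
  unfold mswap. rewrite (swap_hexagon HT).
  set (p := castT _ _). set (q := castS _ _).
  rewrite mk_comp. unfold p, q. now rewrite mk_castT, mk_castS, mk_castT.
Qed.

(** The hexagon with two trivial systems makes this swap idempotent; being invertible as well, it is
    the identity. *)
Lemma mswap1 (A : Sys T) : mswap A triv = mid A.
Proof.
  assert (K : mswap A triv @o mswap A triv = mswap A triv).
  { pose proof (mswap_hex A triv triv) as H.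
    rewrite (sc_unitl triv), mtens1l, mtens1r in H. now symmetry. }
  rewrite <- (mcomp1l (A := sc A triv) (f := mswap A triv))
    by (cbn; now rewrite sc_unitl, sc_unitr).
  rewrite <- (mswapK A triv), <- mcompA, K, mswapK, sc_unitr. reflexivity.
Qed.

Lemma mswap1' (A : Sys T) : mswap triv A = mid A.
Proof.
  rewrite <- (mcomp1l (A := A) (f := mswap triv A)) by (cbn; apply sc_unitr).
  rewrite <- (mswap1 A), mswapK. now rewrite sc_unitl, mswap1.
Qed.

(** * Finite sums, physical transformations and tests *)

Lemma add_zerol (A B : Sys T) (f : Tr A B) : tadd (tzero A B) f = f.
Proof. now rewrite (add_comm HT), (add_zero HT). Qed.

Lemma tsum_app (A B : Sys T) (l l' : list (Tr A B)) :
  tsum (l ++ l') = tadd (tsum l) (tsum l').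
Proof.
  induction l as [|x l IH]; cbn.
  - now rewrite add_zerol.
  - fold (tsum (l ++ l')). now rewrite IH, (add_assoc HT).
Qed.

Lemma tsum_perm (A B : Sys T) (l l' : list (Tr A B)) :
  Permutation l l' -> tsum l = tsum l'.
Proof.
  unfold tsum. induction 1; cbn.
  - easy.
  - now rewrite IHPermutation.
  - now rewrite !(add_assoc HT), (add_comm HT x y).
  - congruence.
Qed.

Lemma comp_tsuml (A B C : Sys T) (l : list (Tr B C)) (f : Tr A B) :
  tcomp (tsum l) f = tsum (map (fun g => tcomp g f) l).
Proof.
  induction l as [|x l IH]; cbn; [apply comp_zerol|].
  fold (tsum l). now rewrite (comp_addl HT), IH.
Qed.

Lemma comp_tsumr (A B C : Sys T) (g : Tr B C) (l : list (Tr A B)) :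
  tcomp g (tsum l) = tsum (map (fun f => tcomp g f) l).
Proof.
  induction l as [|x l IH]; cbn; [apply comp_zeror|].
  fold (tsum l). now rewrite (comp_addr HT), IH.
Qed.

Lemma prob_zero : prob (tzero (@triv T) triv) = 0.
Proof. rewrite <- (scal_zero (tid triv)), (prob_scal HT). lra. Qed.

Lemma prob_tsum (l : list (Tr (@triv T) triv)) :
  prob (tsum l) = fold_right Rplus 0 (map prob l).
Proof.
  induction l as [|x l IH]; cbn; [apply prob_zero|].
  fold (tsum l). now rewrite (prob_add HT), IH.
Qed.

Lemma isTest_castT (A B B' : Sys T) (e : B = B') (l : list (Tr A B)) :
  isTest l -> isTest (map (castT e) l).
Proof. destruct e; cbn. now rewrite map_id. Qed.

Lemma phys_castT (A B B' : Sys T) (e : B = B') (f : Tr A B) :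
  phys f -> phys (castT e f).
Proof. now destruct e. Qed.

Lemma phys_castS (A A' B : Sys T) (e : A = A') (f : Tr A B) :
  phys f -> phys (castS e f).
Proof. now destruct e. Qed.

Lemma test_in_phys (A B : Sys T) (l : list (Tr A B)) (f : Tr A B) :
  isTest l -> In f l -> phys f.
Proof.
  intros Hl Hf. pose proof (test_phys HT Hl) as H.
  rewrite Forall_forall in H. auto.
Qed.

Lemma phys_comp (A B C : Sys T) (g : Tr B C) (f : Tr A B) :
  phys g -> phys f -> phys (tcomp g f).
Proof.
  intros (lg & Tg & Ig)%(phys_test HT) (lf & Tf & If)%(phys_test HT).
  apply (test_in_phys (test_seq HT Tf Tg)). apply in_flat_map.
  exists f; split; [easy|]. apply in_map_iff. eauto.
Qed.

Lemma phys_tens (A B C D : Sys T) (f : Tr A B) (g : Tr C D) :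
  phys f -> phys g -> phys (ttens f g).
Proof.
  intros (lf & Tf & If)%(phys_test HT) (lg & Tg & Ig)%(phys_test HT).
  apply (test_in_phys (test_par HT Tf Tg)). apply in_flat_map.
  exists f; split; [easy|]. apply in_map_iff. eauto.
Qed.

Lemma phys_id (A : Sys T) : phys (tid A).
Proof. apply (test_in_phys (test_id HT A)). now left. Qed.

Lemma phys_swap (A B : Sys T) : phys (swap A B).
Proof. apply (test_in_phys (swap_test HT A B)). now left. Qed.

Lemma phys_deff (A : Sys T) : phys (deff A).
Proof. apply (test_in_phys (deff_test HT A)). now left. Qed.

(** Coarse-graining into a single block. The member [f] shows that the list is nonempty, since every
    block must contain an outcome. *)
Lemma test_tsum (A B : Sys T) (l : list (Tr A B)) (f : Tr A B) :
  isTest l -> In f l -> isTest [tsum l].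
Proof.
  intros Hl If.
  assert (K : forall (l : list (Tr A B)) n, map snd (filter
     (fun p : nat * Tr A B => Nat.eqb 0 0) (combine (seq n (length l)) l)) = l).
  { clear. induction l as [|x l IH]; intros n; cbn in *; [easy|]. now rewrite IH. }
  pose proof (@test_coarse T HT A B l 1 (fun _ => 0%nat) Hl) as H.
  cbn [seq map] in H. rewrite K in H. apply H; [lia|].
  intros k Hk. exists 0%nat. destruct l; cbn; [easy|lia].
Qed.

Lemma test_state_deff (A : Sys T) (rho : Tr triv A) :
  isTest [rho] -> tcomp (deff A) rho = tid triv.
Proof.
  intros H. pose proof (test_seq HT H (deff_test HT A)) as K. cbn in K.
  apply (test_prob HT) in K. cbn in K.
  apply (prob_inj HT). rewrite (prob_id HT). lra.
Qed.

Lemma test_state_normalized (A : Sys T) (rho : Tr triv A) :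
  isTest [rho] -> normalized rho.
Proof.
  intros H. split; [apply (test_in_phys H); now left|].
  rewrite (test_state_deff H). apply (prob_id HT).
Qed.

Lemma normalized_deff (A : Sys T) (rho : Tr triv A) :
  normalized rho -> tcomp (deff A) rho = tid triv.
Proof. intros [_ H]. apply (prob_inj HT). now rewrite H, (prob_id HT). Qed.

(** Coarse-graining gives a one-outcome observation test, and causality leaves only one such
    effect. *)
Lemma effect_test_tsum (A : Sys T) (l : list (Tr A triv)) (a : Tr A triv) :
  isTest l -> In a l -> tsum l = deff A.
Proof. intros Hl Ha. apply (deff_unique HT). now apply test_tsum with a. Qed.

Lemma le_sum_of_nonneg (X : Type) (f : X -> R) (l : list X) (x : X) :
  (forall y, In y l -> 0 <= f y) -> In x l ->
  f x <= fold_right Rplus 0 (map f l).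
Proof.
  intros H0 Hx.
  assert (K : forall l', (forall y, In y l' -> 0 <= f y) ->
    0 <= fold_right Rplus 0 (map f l')).
  { induction l' as [|y l' IH]; cbn; intros H; [lra|].
    pose proof (H y (or_introl eq_refl)).
    specialize (IH (fun z h => H z (or_intror h))). lra. }
  induction l as [|y l IH]; cbn in *; [easy|].
  destruct Hx as [->|Hx].
  - specialize (K l (fun z h => H0 z (or_intror h))). lra.
  - specialize (IH (fun z h => H0 z (or_intror h)) Hx).
    pose proof (H0 y (or_introl eq_refl)). lra.
Qed.

(** * Refinements of normalized states *)

Lemma prob_nonneg (A : Sys T) (a : Tr A triv) (rho : Tr triv A) :
  phys a -> phys rho -> 0 <= prob (tcomp a rho).
Proof. intros Ha Hr. apply (phys_prob HT). now apply phys_comp. Qed.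

Lemma prob_le_deff (A : Sys T) (a : Tr A triv) (rho : Tr triv A) :
  phys a -> phys rho -> prob (tcomp a rho) <= prob (tcomp (deff A) rho).
Proof.
  intros (l & Hl & Ha)%(phys_test HT) Hr.
  rewrite <- (effect_test_tsum Hl Ha), comp_tsuml, prob_tsum, map_map.
  apply (@le_sum_of_nonneg _ (fun b => prob (tcomp b rho))); [|easy].
  intros b Hb. apply prob_nonneg; [|easy]. now apply (test_in_phys Hl).
Qed.

Lemma null_state (A : Sys T) (rho : Tr triv A) :
  phys rho -> prob (tcomp (deff A) rho) <= 0 -> rho = tzero triv A.
Proof.
  intros Hr H0. apply (state_sep HT). intros a Ha.
  rewrite comp_zeror, prob_zero.
  pose proof (prob_nonneg Ha Hr). pose proof (prob_le_deff Ha Hr). lra.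
Qed.

(** The total weight of a preparation test is one and [l0] already uses it up, so each state in [l1]
    has weight zero and vanishes. *)
Lemma test_residual (A : Sys T) (l0 l1 : list (Tr triv A)) :
  isTest (l0 ++ l1) -> normalized (tsum l0) -> tsum l1 = tzero triv A.
Proof.
  intros H HN. destruct l1 as [|x l1]; [easy|]. set (l := x :: l1) in *.
  assert (Hx : In x (l0 ++ l)) by (apply in_app_iff; right; now left).
  pose proof (test_state_deff (test_tsum H Hx)) as K.
  rewrite tsum_app, (comp_addr HT), (normalized_deff HN) in K.
  apply (f_equal prob) in K. rewrite (prob_add HT), (prob_id HT) in K.
  rewrite comp_tsumr, prob_tsum, map_map in K.
  assert (Z : forall y, In y l -> y = tzero triv A).
  { intros y Hy.
    assert (P : forall z, In z l -> phys z).
    { intros z Hz. apply (test_in_phys H). apply in_app_iff; now right. }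
    apply null_state; [auto|].
    pose proof (@le_sum_of_nonneg _ (fun y => prob (tcomp (deff A) y)) l y) as L.
    cbn beta in L. apply (Rle_trans _ _ _ (L (fun z h => prob_nonneg (phys_deff A) (P z h)) Hy)).
    lra. }
  clear - Z HT. induction l as [|y l IH]; [easy|]. cbn.
  rewrite (Z y (or_introl eq_refl)), add_zerol. apply IH. intros z Hz. apply Z. now right.
Qed.

(** The branches outside the block vanish, so adding them to the sum changes nothing: the whole test
    may be taken as the decomposition. *)
Lemma refines_normalized (A : Sys T) (D rho : Tr triv A) :
  normalized rho -> refines D rho ->
  exists l, isTest (D :: l) /\ tsum (D :: l) = rho.
Proof.
  intros HN (l & l0 & l1 & Hl & HP & -> & HD).
  apply (test_perm HT) with (l' := l0 ++ l1) in Hl; [|easy].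
  pose proof (test_residual Hl HN) as Z.
  destruct (in_split D l0 HD) as (u & v & ->).
  exists (u ++ v ++ l1). split.
  - apply (test_perm HT Hl). rewrite <- app_assoc. cbn. symmetry. apply Permutation_middle.
  - rewrite <- (add_zero HT (tsum (u ++ D :: v))), <- Z, <- tsum_app.
    apply tsum_perm. rewrite <- app_assoc. cbn. apply Permutation_middle.
Qed.

(** A normalized state is thus deterministically preparable: in a test containing it the other
    outcomes vanish, and the test may be coarse-grained. *)
Lemma normalized_isTest (A : Sys T) (rho : Tr triv A) :
  normalized rho -> isTest [rho].
Proof.
  intros HN. destruct (phys_test HT (proj1 HN)) as (l & Hl & Hr).
  destruct (in_split rho l Hr) as (u & v & ->).
  destruct (@refines_normalized A rho rho HN) as (l' & Hl' & E).
  { exists (u ++ rho :: v), [rho], (u ++ v). repeat split; try easy.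
    - symmetry. exact (Permutation_middle u v _).
    - cbn. now rewrite (add_zero HT).
    - now left. }
  rewrite <- E. apply test_tsum with rho; [easy|now left].
Qed.

Lemma refines_phys (A B : Sys T) (D C : Tr A B) : refines D C -> phys D.
Proof.
  intros (l & l0 & l1 & Hl & HP & _ & HD). apply (test_in_phys Hl).
  rewrite HP. apply in_app_iff. now left.
Qed.

Lemma refines_refl (A B : Sys T) (C : Tr A B) : phys C -> refines C C.
Proof.
  intros (l & Hl & HC)%(phys_test HT). destruct (in_split C l HC) as (u & v & ->).
  exists (u ++ C :: v), [C], (u ++ v). repeat split; try easy.
  - symmetry. exact (Permutation_middle u v _).
  - cbn. now rewrite (add_zero HT).
  - now left.
Qed.

Lemma refines_comp_test (A B C : Sys T) (D rho : Tr A B) (l : list (Tr B C)) (F : Tr B C) :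
  refines D rho -> isTest l -> In F l -> refines (tcomp F D) (tcomp (tsum l) rho).
Proof.
  intros (k & l0 & l1 & Hk & HP & -> & HD) Hl HF.
  set (g := fun c : Tr A B => map (fun d : Tr B C => tcomp d c) l).
  exists (flat_map g k), (flat_map g l0), (flat_map g l1). repeat split.
  - exact (test_seq HT Hk Hl).
  - rewrite <- flat_map_app. now apply Permutation_flat_map.
  - clear HD HP. induction l0 as [|c l0 IH]; cbn; [apply comp_zeror|].
    change (tcomp (tsum l) (tadd c (tsum l0)) = tsum (g c ++ flat_map g l0)).
    now rewrite tsum_app, <- IH, (comp_addr HT), comp_tsuml.
  - apply in_flat_map. exists D; split; [easy|]. apply in_map_iff. eauto.
Qed.

Lemma refines_comp (A B C : Sys T) (D rho : Tr A B) (F : Tr B C) :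
  refines D rho -> phys F -> refines (tcomp F D) (tcomp F rho).
Proof.
  intros (k & l0 & l1 & Hk & HP & -> & HD) (l & Hl & HF)%(phys_test HT).
  destruct (in_split F l HF) as (u & v & ->).
  apply (test_perm HT) with (l' := F :: u ++ v) in Hl;
    [|symmetry; apply Permutation_middle].
  set (g := fun c : Tr A B => map (fun d : Tr B C => tcomp d c) (u ++ v)).
  (* The composite test interleaves the outcomes through [F] with the rest; this permutation
     collects them in front, so that they can form the block. *)
  assert (E : forall m, Permutation (flat_map (fun c => tcomp F c :: g c) m)
     (map (tcomp F) m ++ flat_map g m)).
  { induction m as [|c m IH]; cbn; [easy|]. apply perm_skip. rewrite IH.
    rewrite !app_assoc. apply Permutation_app_tail, Permutation_app_comm. }
  exists (flat_map (fun c => tcomp F c :: g c) k), (map (tcomp F) l0),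
    (map (tcomp F) l1 ++ flat_map g k). repeat split.
  - exact (test_seq HT Hk Hl).
  - rewrite E, app_assoc, <- map_app. apply Permutation_app_tail.
    now apply Permutation_map.
  - apply comp_tsumr.
  - now apply in_map.
Qed.

(** * Local effects, local preparations and marginals *)

Definition effR (A B : Sys T) (b : Tr B triv) : Tr (sc A B) A :=
  castT (sc_unitr A) (ttens (tid A) b).
Definition effL (A B : Sys T) (a : Tr A triv) : Tr (sc A B) B :=
  castT (sc_unitl B) (ttens a (tid B)).
Definition prepR (A X : Sys T) (phi : Tr triv X) : Tr A (sc A X) :=
  castS (sc_unitr A) (ttens (tid A) phi).
Definition pairst (A B : Sys T) (phi : Tr triv A) (psi : Tr triv B) : Tr triv (sc A B) :=
  castS (sc_unitl triv) (ttens phi psi).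

Ltac tomor := repeat (progress rewrite ?mk_castT, ?mk_castS, ?mk_comp, ?mk_tens, ?mk_id).

Lemma mk_effR (A B : Sys T) (b : Tr B triv) : mk (effR A b) = mid A @x mk b.
Proof. unfold effR. now tomor. Qed.

Lemma mk_effL (A B : Sys T) (a : Tr A triv) : mk (effL B a) = mk a @x mid B.
Proof. unfold effL. now tomor. Qed.

Lemma mk_prepR (A X : Sys T) (phi : Tr triv X) : mk (prepR A phi) = mid A @x mk phi.
Proof. unfold prepR. now tomor. Qed.

Lemma mk_pairst (A B : Sys T) (phi : Tr triv A) (psi : Tr triv B) :
  mk (pairst phi psi) = mk phi @x mk psi.
Proof. unfold pairst. now tomor. Qed.

Lemma marg1E (A B : Sys T) (Psi : Tr triv (sc A B)) :
  marg1 Psi = tcomp (effR A (deff B)) Psi.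
Proof. apply mk_inj. unfold marg1. tomor. now rewrite mk_effR. Qed.

Lemma marg2E (A B : Sys T) (Psi : Tr triv (sc A B)) :
  marg2 Psi = tcomp (effL B (deff A)) Psi.
Proof. apply mk_inj. unfold marg2. tomor. now rewrite mk_effL. Qed.

Lemma mk_deff_sc (A B : Sys T) : mk (deff (sc A B)) = mk (deff A) @x mk (deff B).
Proof. rewrite (deff_tens HT). unfold prod_eff. now tomor. Qed.

Lemma deff_triv : deff (@triv T) = tid triv.
Proof. symmetry. apply (deff_unique HT), (test_id HT). Qed.

Lemma mk_marg1 (A B : Sys T) (Psi : Tr triv (sc A B)) :
  mk (marg1 Psi) = (mid A @x mk (deff B)) @o mk Psi.
Proof. now rewrite marg1E, mk_comp, mk_effR. Qed.

Lemma mk_marg2 (A B : Sys T) (Psi : Tr triv (sc A B)) :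
  mk (marg2 Psi) = (mk (deff A) @x mid B) @o mk Psi.
Proof. now rewrite marg2E, mk_comp, mk_effL. Qed.

Lemma phys_pairst (A B : Sys T) (phi : Tr triv A) (psi : Tr triv B) :
  phys phi -> phys psi -> phys (pairst phi psi).
Proof. intros H K. now apply phys_castS, phys_tens. Qed.

Lemma prod_effR (A B : Sys T) (a : Tr A triv) (b : Tr B triv) (rho : Tr triv (sc A B)) :
  tcomp (prod_eff a b) rho = tcomp a (tcomp (effR A b) rho).
Proof.
  apply mk_inj. unfold prod_eff. tomor. rewrite mk_effR, mcompA. f_equal.
  rewrite <- (mtens1r (mk a)) at 2. now rewrite mtens_slide by obj.
Qed.

Lemma prod_effL (A B : Sys T) (a : Tr A triv) (b : Tr B triv) (rho : Tr triv (sc A B)) :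
  tcomp (prod_eff a b) rho = tcomp b (tcomp (effL B a) rho).
Proof.
  apply mk_inj. unfold prod_eff. tomor. rewrite mk_effL, mcompA. f_equal.
  rewrite <- (mtens1l (mk b)) at 2. now rewrite mtens_slide' by obj.
Qed.

(** Local discriminability in sequential form: first condition on an effect of one factor, then test
    the other. *)
Lemma local_ext (A B : Sys T) (rho rho' : Tr triv (sc A B)) :
  phys rho -> phys rho' ->
  (forall (a : Tr A triv) (b : Tr B triv), phys a -> phys b ->
    prob (tcomp a (tcomp (effR A b) rho)) = prob (tcomp a (tcomp (effR A b) rho'))) ->
  rho = rho'.
Proof.
  intros H H' K. apply (loc_disc HT); [easy..|]. intros a b Ha Hb.
  rewrite !prod_effR. auto.
Qed.

Lemma scalarE (p : Tr (@triv T) triv) : p = tscal (prob p) (tid triv).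
Proof. apply (prob_inj HT). rewrite (prob_scal HT), (prob_id HT). lra. Qed.

Lemma comp_scalar (B : Sys T) (f : Tr triv B) (p : Tr triv triv) :
  tcomp f p = tscal (prob p) f.
Proof. rewrite (scalarE p) at 1. now rewrite (comp_scalr HT), (comp_idr HT). Qed.

Lemma effR_pairst (A B : Sys T) (phi : Tr triv A) (psi : Tr triv B) (b : Tr B triv) :
  tcomp (effR A b) (pairst phi psi) = tcomp phi (tcomp b psi).
Proof.
  apply mk_inj. tomor. rewrite mk_effR, mk_pairst.
  rewrite mtensC by obj. rewrite mcomp1l by obj.
  rewrite <- (mtens_slide (A := triv) (B := triv)) by obj.
  now rewrite mtens1l, mtens1r.
Qed.

Lemma effL_pairst (A B : Sys T) (phi : Tr triv A) (psi : Tr triv B) (a : Tr A triv) :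
  tcomp (effL B a) (pairst phi psi) = tcomp psi (tcomp a phi).
Proof.
  apply mk_inj. tomor. rewrite mk_effL, mk_pairst.
  rewrite mtensC by obj. rewrite mcomp1l by obj.
  rewrite <- (mtens_slide' (A := triv) (B := triv)) by obj.
  now rewrite mtens1l, mtens1r.
Qed.

Lemma marg1_pairst (A B : Sys T) (phi : Tr triv A) (psi : Tr triv B) :
  normalized psi -> marg1 (pairst phi psi) = phi.
Proof.
  intros H. now rewrite marg1E, effR_pairst, (normalized_deff H), (comp_idr HT).
Qed.

Lemma marg2_pairst (A B : Sys T) (phi : Tr triv A) (psi : Tr triv B) :
  normalized phi -> marg2 (pairst phi psi) = psi.
Proof.
  intros H. now rewrite marg2E, effL_pairst, (normalized_deff H), (comp_idr HT).
Qed.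

Lemma deff_effR (A B : Sys T) : tcomp (deff A) (effR A (deff B)) = deff (sc A B).
Proof.
  apply mk_inj. rewrite mk_comp, mk_effR, mk_deff_sc.
  rewrite <- (mtens1r (mk (deff A))) at 1. now apply mtens_slide.
Qed.

Lemma deff_effL (A B : Sys T) : tcomp (deff B) (effL B (deff A)) = deff (sc A B).
Proof.
  apply mk_inj. rewrite mk_comp, mk_effL, mk_deff_sc.
  rewrite <- (mtens1l (mk (deff B))) at 1. now apply mtens_slide'.
Qed.

(** * Channels and normalization *)

Lemma channel_normalized (A B : Sys T) (C : Tr A B) (rho : Tr triv A) :
  channel C -> normalized rho -> normalized (tcomp C rho).
Proof.
  intros [PC EC] [Pr Er]. split; [now apply phys_comp|].
  now rewrite (comp_assoc HT), EC.
Qed.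

Lemma channel_comp (A B C : Sys T) (G : Tr B C) (F : Tr A B) :
  channel G -> channel F -> channel (tcomp G F).
Proof.
  intros [PG EG] [PF EF]. split; [now apply phys_comp|].
  now rewrite (comp_assoc HT), EG.
Qed.

Lemma channel_id (A : Sys T) : channel (tid A).
Proof. split; [apply phys_id|apply (comp_idr HT)]. Qed.

Lemma channel_tens (A B C D : Sys T) (F : Tr A B) (G : Tr C D) :
  channel F -> channel G -> channel (ttens F G).
Proof.
  intros [PF EF] [PG EG]. split; [now apply phys_tens|].
  apply mk_inj. tomor. rewrite !mk_deff_sc, mtensC by obj.
  now rewrite <- !mk_comp, EF, EG.
Qed.

Lemma channel_castT (A B B' : Sys T) (e : B = B') (F : Tr A B) :
  channel F -> channel (castT e F).
Proof. now destruct e. Qed.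

Lemma channel_castS (A A' B : Sys T) (e : A = A') (F : Tr A B) :
  channel F -> channel (castS e F).
Proof. now destruct e. Qed.

Lemma channel_deff (A : Sys T) : channel (deff A).
Proof. split; [apply phys_deff|]. now rewrite deff_triv, (comp_idl HT). Qed.

Lemma channel_effR (A B : Sys T) : channel (effR A (deff B)).
Proof. apply channel_castT, channel_tens; [apply channel_id|apply channel_deff]. Qed.

Lemma channel_effL (A B : Sys T) : channel (effL B (deff A)).
Proof. apply channel_castT, channel_tens; [apply channel_deff|apply channel_id]. Qed.

Lemma channel_state (A : Sys T) (rho : Tr triv A) : normalized rho -> channel rho.
Proof. intros H. split; [apply H|]. now rewrite (normalized_deff H), deff_triv. Qed.

Lemma channel_prepR (A B : Sys T) (phi : Tr triv B) :
  normalized phi -> channel (prepR A phi).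
Proof. intros H. apply channel_castS, channel_tens; [apply channel_id|now apply channel_state]. Qed.

Lemma channel_swap (A B : Sys T) : channel (swap A B).
Proof.
  split; [apply phys_swap|]. apply mk_inj. rewrite mk_comp, !mk_deff_sc.
  change (mk (swap A B)) with (mswap A B).
  rewrite <- (mswap_nat (B := triv) (D := triv)) by obj.
  rewrite mswap1. apply mcomp1l. obj.
Qed.

Lemma normalized_pairst (A B : Sys T) (phi : Tr triv A) (psi : Tr triv B) :
  normalized phi -> normalized psi -> normalized (pairst phi psi).
Proof.
  intros H K. split; [apply phys_pairst; [apply H|apply K]|].
  rewrite <- deff_effR, <- (comp_assoc HT), <- marg1E, marg1_pairst by easy. apply H.
Qed.

Lemma normalized_marg1 (A B : Sys T) (Psi : Tr triv (sc A B)) :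
  normalized Psi -> normalized (marg1 Psi).
Proof. intros H. rewrite marg1E. apply channel_normalized; [apply channel_effR|easy]. Qed.

Lemma normalized_marg2 (A B : Sys T) (Psi : Tr triv (sc A B)) :
  normalized Psi -> normalized (marg2 Psi).
Proof. intros H. rewrite marg2E. apply channel_normalized; [apply channel_effL|easy]. Qed.

Lemma castT_tsum (A B B' : Sys T) (e : B = B') (l : list (Tr A B)) :
  castT e (tsum l) = tsum (map (castT e) l).
Proof. destruct e; cbn. now rewrite map_id. Qed.

Lemma tens_tsumr (A B C D : Sys T) (f : Tr A B) (l : list (Tr C D)) :
  ttens f (tsum l) = tsum (map (ttens f) l).
Proof.
  induction l as [|g l IH]; cbn.
  - rewrite <- (scal_zero (tzero C D)), (tens_scalr HT). apply scal_zero.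
  - fold (tsum l). now rewrite (tens_addr HT), IH.
Qed.

Lemma tens_tsuml (A B C D : Sys T) (l : list (Tr A B)) (g : Tr C D) :
  ttens (tsum l) g = tsum (map (fun f => ttens f g) l).
Proof.
  induction l as [|f l IH]; cbn.
  - rewrite <- (scal_zero (tzero A B)), (tens_scall HT). apply scal_zero.
  - fold (tsum l). now rewrite (tens_addl HT), IH.
Qed.

(** * Refinements of marginals and pure product states *)

(** Complete [b] to an observation test. Its effects sum to [deff B], so conditioning on them is a
    test whose sum is marginalization. *)
Lemma refines_effR (A B : Sys T) (D Psi : Tr triv (sc A B)) (b : Tr B triv) :
  refines D Psi -> phys b -> refines (tcomp (effR A b) D) (marg1 Psi).
Proof.
  intros H (l & Hl & Hb)%(phys_test HT).
  assert (E : tsum (map (@effR A B) l) = effR A (deff B)).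
  { rewrite <- (effect_test_tsum Hl Hb). unfold effR.
    now rewrite tens_tsumr, castT_tsum, map_map. }
  rewrite marg1E, <- E. apply refines_comp_test; [easy| |now apply in_map].
  unfold effR. rewrite <- (map_map (ttens (tid A)) (castT (sc_unitr A))).
  apply isTest_castT. pose proof (test_par HT (test_id HT A) Hl) as K.
  cbn in K. now rewrite app_nil_r in K.
Qed.

Lemma refines_effL (A B : Sys T) (D Psi : Tr triv (sc A B)) (a : Tr A triv) :
  refines D Psi -> phys a -> refines (tcomp (effL B a) D) (marg2 Psi).
Proof.
  intros H (l & Hl & Ha)%(phys_test HT).
  assert (E : tsum (map (@effL A B) l) = effL B (deff A)).
  { rewrite <- (effect_test_tsum Hl Ha). unfold effL.
    now rewrite tens_tsuml, castT_tsum, map_map. }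
  rewrite marg2E, <- E. apply refines_comp_test; [easy| |now apply in_map].
  unfold effL. rewrite <- (map_map (fun f => ttens f (tid B)) (castT (sc_unitl B))).
  apply isTest_castT. pose proof (test_par HT Hl (test_id HT B)) as K.
  cbn in K. replace (map _ l) with (flat_map (fun c => [ttens c (tid B)]) l); [easy|].
  clear. induction l as [|c l IH]; cbn; [|rewrite IH]; easy.
Qed.

(** Conditioning a refinement [D] on [b] gives a multiple of [phi], and discarding the first factor
    gives a multiple of [psi]. These scalars fix all probabilities of [D] on product effects, and
    local discriminability concludes. *)
Lemma pure_pairst (A B : Sys T) (phi : Tr triv A) (psi : Tr triv B) :
  pure phi -> normalized phi -> pure psi -> normalized psi -> pure (pairst phi psi).
Proof.
  intros [_ Ap] Np [_ As] Ns.
  split; [apply phys_pairst; [apply Np|apply Ns]|]. intros D HD.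
  pose proof (refines_phys HD) as PD.
  (* The factor of proportionality must be the total weight of [D], as the product state is
     normalized. *)
  set (p := tcomp (deff (sc A B)) D).
  exists (prob p). split.
  { apply (phys_prob HT), phys_comp; [apply phys_deff|easy]. }
  rewrite <- comp_scalar. apply local_ext; [easy| |].
  { apply phys_comp; [apply phys_pairst; [apply Np|apply Ns]|].
    apply phys_comp; [apply phys_deff|easy]. }
  intros a b Ha Hb.
  pose proof (refines_effR HD Hb) as R1. rewrite marg1_pairst in R1 by easy.
  pose proof (refines_effL HD (phys_deff A)) as R2. rewrite marg2_pairst in R2 by easy.
  destruct (Ap _ R1) as (l & _ & E1). destruct (As _ R2) as (m & _ & E2).
  assert (Em : prob p = m).
  { unfold p. rewrite <- deff_effL, <- (comp_assoc HT), E2, (comp_scalr HT), (prob_scal HT).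
    rewrite (proj2 Ns). lra. }
  (* Both sides compute the weight of [b] in the second marginal of [D]. *)
  assert (El : l = m * prob (tcomp b psi)).
  { rewrite <- (prob_scal HT), <- (comp_scalr HT), <- E2, <- prod_effL, prod_effR, E1.
    rewrite (comp_scalr HT), (prob_scal HT), (proj2 Np). lra. }
  rewrite E1, (comp_assoc HT (effR A b)), effR_pairst.
  rewrite !comp_scalar, !(comp_scalr HT), !(prob_scal HT). rewrite El, Em. ring.
Qed.

(* Conditioning a pure marginal on any effect only rescales it, so nothing can be correlated with it. *)
Lemma pure_marginal_product (A B : Sys T) (tau : Tr triv (sc A B)) :
  normalized tau -> atomic (marg1 tau) -> tau = pairst (marg1 tau) (marg2 tau).
Proof.
  intros Nt At. apply local_ext; [apply Nt| |].
  { apply phys_pairst; [apply (normalized_marg1 Nt)|apply (normalized_marg2 Nt)]. }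
  intros a b Ha Hb.
  destruct (At _ (refines_effR (refines_refl (proj1 Nt)) Hb)) as (l & _ & E).
  assert (El : l = prob (tcomp b (marg2 tau))).
  { rewrite marg2E, <- prod_effL, prod_effR, E, (comp_scalr HT), (prob_scal HT).
    rewrite (proj2 (normalized_marg1 Nt)). lra. }
  rewrite effR_pairst, comp_scalar, E, El. easy.
Qed.

(** * Reversible channels and their action on pure states *)

Lemma pure_castT (A A' : Sys T) (e : A = A') (rho : Tr triv A) :
  pure rho -> pure (castT e rho).
Proof. now destruct e. Qed.

Lemma normalized_castT (A A' : Sys T) (e : A = A') (rho : Tr triv A) :
  normalized rho -> normalized (castT e rho).
Proof. now destruct e. Qed.

(** The inverse channel carries refinements of the image back to refinements of [rho]. *)
Lemma pure_reversible (A B : Sys T) (U : Tr A B) (rho : Tr triv A) :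
  reversible U -> pure rho -> pure (tcomp U rho).
Proof.
  intros [CU (W & CW & WU & UW)] [Pr Ar]. split; [apply phys_comp; [apply CU|easy]|].
  intros D HD. pose proof (refines_comp HD (proj1 CW)) as K.
  rewrite (comp_assoc HT), WU, (comp_idl HT) in K.
  destruct (Ar _ K) as (l & Hl & E). exists l; split; [easy|].
  now rewrite <- (comp_scalr HT), <- E, (comp_assoc HT), UW, (comp_idl HT).
Qed.

Lemma reversible_id (A : Sys T) : reversible (tid A).
Proof.
  split; [apply channel_id|]. exists (tid A).
  split; [apply channel_id|]. now rewrite (comp_idl HT).
Qed.

Lemma reversible_comp (A B C : Sys T) (V : Tr B C) (U : Tr A B) :
  reversible V -> reversible U -> reversible (tcomp V U).
Proof.
  intros [CV (V' & CV' & V'V & VV')] [CU (U' & CU' & U'U & UU')].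
  split; [now apply channel_comp|]. exists (tcomp U' V').
  split; [now apply channel_comp|]. split.
  - now rewrite <- (comp_assoc HT), (comp_assoc HT V'), V'V, (comp_idl HT).
  - now rewrite <- (comp_assoc HT), (comp_assoc HT U), UU', (comp_idl HT).
Qed.

Lemma reversible_tens (A B C D : Sys T) (U : Tr A B) (V : Tr C D) :
  reversible U -> reversible V -> reversible (ttens U V).
Proof.
  intros [CU (U' & CU' & U'U & UU')] [CV (V' & CV' & V'V & VV')].
  split; [now apply channel_tens|]. exists (ttens U' V').
  split; [now apply channel_tens|].
  now rewrite !(tens_comp HT), U'U, UU', V'V, VV', !(tens_id HT).
Qed.

Lemma reversible_castT (A B B' : Sys T) (e : B = B') (U : Tr A B) :
  reversible U -> reversible (castT e U).
Proof. now destruct e. Qed.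

Lemma reversible_swap (A B : Sys T) : reversible (swap A B).
Proof.
  split; [apply channel_swap|]. exists (swap B A).
  split; [apply channel_swap|]. split; apply (swap_invol HT).
Qed.

(** No signalling: a channel followed by discarding is discarding. *)
Lemma marg1_local (A B C : Sys T) (N : Tr B C) (Psi : Tr triv (sc A B)) :
  channel N -> marg1 (tcomp (ttens (tid A) N) Psi) = marg1 Psi.
Proof.
  intros [_ E]. apply mk_inj. rewrite !mk_marg1. tomor.
  rewrite mcompA, mtensC, mcomp1l by obj. now rewrite <- mk_comp, E.
Qed.


Lemma marg1_swap (A B : Sys T) (Psi : Tr triv (sc A B)) :
  marg1 (tcomp (swap A B) Psi) = marg2 Psi.
Proof.
  apply mk_inj. rewrite mk_marg1, mk_marg2, mk_comp, mcompA. f_equal.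
  change (mk (swap A B)) with (mswap A B).
  rewrite <- (mswap_nat (B := triv) (D := B)) by obj.
  rewrite mswap1'. apply mcomp1l. obj.
Qed.

Lemma purification_reversible (A B C : Sys T) (rho : Tr triv A) (Psi : Tr triv (sc A B)) (U : Tr B C) :
  purification rho Psi -> reversible U -> purification rho (tcomp (ttens (tid A) U) Psi).
Proof.
  intros (Pp & Np & <-) HU.
  assert (R : reversible (ttens (tid A) U)) by (apply reversible_tens; [apply reversible_id|easy]).
  repeat split.
  - apply phys_comp; [apply R|apply Np].
  - now apply pure_reversible.
  - apply phys_comp; [apply R|apply Np].
  - apply channel_normalized; [apply R|easy].
  - apply marg1_local, HU.
Qed.

Context (HP : PurificationPostulate T).

(** * Comparison of purifications with different purifying systems *)

(** Move [Psi'] to the purifying system [B] along [P], apply the postulate there, and return by the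
    inverse of [P]. *)
Lemma purification_unique_iso (A B B' : Sys T) (rho : Tr triv A)
    (Psi : Tr triv (sc A B)) (Psi' : Tr triv (sc A B')) (P : Tr B' B) :
  purification rho Psi -> purification rho Psi' -> reversible P ->
  exists U : Tr B B', reversible U /\ Psi' = tcomp (ttens (tid A) U) Psi.
Proof.
  intros H H' [CP (Q & CQ & QP & PQ)].
  assert (RP : reversible P) by (split; [easy|]; now exists Q).
  assert (RQ : reversible Q) by (split; [easy|]; now exists P).
  destruct (proj2 HP _ _ _ _ _ H (purification_reversible H' RP)) as (U & RU & E).
  exists (tcomp Q U). split; [now apply reversible_comp|].
  rewrite <- (comp_idl HT (tid A)), <- (tens_comp HT), <- (comp_assoc HT), <- E.
  rewrite (comp_assoc HT), (tens_comp HT), (comp_idl HT), QP, (tens_id HT).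
  now rewrite (comp_idl HT).
Qed.

(* Each purification serves as the ancilla of the other: [Psi (x) Psi'] and
   [Psi' (x) Psi] purify the same state with isomorphic purifying systems. *)
Lemma purification_exchange (A B C : Sys T) (rho : Tr triv A)
    (Psi : Tr triv (sc A B)) (Psi' : Tr triv (sc A C)) :
  purification rho Psi -> purification rho Psi' ->
  exists U : Tr (sc B (sc A C)) (sc C (sc A B)), reversible U /\
    (mid A @x mk U) @o (mk Psi @x mk Psi') = mk Psi' @x mk Psi.
Proof.
  assert (K : forall (B C : Sys T) (Psi : Tr triv (sc A B)) (Psi' : Tr triv (sc A C)),
    purification rho Psi -> purification rho Psi' ->
    purification rho (castT (eq_sym (sc_assoc A B (sc A C))) (pairst Psi Psi'))).
  { clear - HT. intros B C Psi Psi' (Pp & Np & M) (Pp' & Np' & M').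
    assert (N : normalized (castT (eq_sym (sc_assoc A B (sc A C))) (pairst Psi Psi'))).
    { now apply normalized_castT, normalized_pairst. }
    split; [now apply pure_castT, pure_pairst|]. split; [easy|].
    rewrite <- M. apply mk_inj. rewrite !mk_marg1, mk_castT, mk_pairst, mk_deff_sc, mtensA.
    rewrite mtensC by obj. rewrite <- (mk_comp (deff _) Psi'), (normalized_deff Np').
    now rewrite mtens1r. }
  intros H H'.
  (* The isomorphism from [C(AB)] to [B(AC)] first moves [C] to the end and then exchanges [A] and
     [B]. *)
  destruct (@purification_unique_iso A _ _ rho _ _
    (castT (eq_sym (sc_assoc B A C)) (tcomp (ttens (swap A B) (tid C)) (swap C (sc A B))))
    (K _ _ _ _ H H') (K _ _ _ _ H' H)) as (U & RU & E).
  { apply reversible_castT, reversible_comp; [|apply reversible_swap].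
    apply reversible_tens; [apply reversible_swap|apply reversible_id]. }
  exists U. split; [easy|]. apply (f_equal mk) in E.
  rewrite mk_comp, mk_tens, !mk_castT, !mk_pairst in E. now symmetry.
Qed.

Lemma mtens_states (A : Sys T) (f g : Mor T) :
  dom f = triv -> cod g = A -> dom g = triv -> (mid A @x f) @o g = g @x f.
Proof.
  intros Hf <- Hg. rewrite <- (mtens1r g) at 2. rewrite mtensC by (cbn; congruence).
  now rewrite mcomp1l, mcomp1r.
Qed.

(** Prepare [Psi'] next to [B], apply the reversible exchange, and discard the copy of [Psi] that it
    produces on the ancilla. *)
Lemma purification_channel (A B C : Sys T) (rho : Tr triv A)
    (Psi : Tr triv (sc A B)) (Psi' : Tr triv (sc A C)) :
  purification rho Psi -> purification rho Psi' ->
  exists N : Tr B C, channel N /\ tcomp (ttens (tid A) N) Psi = Psi'.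
Proof.
  intros H H'. destruct (purification_exchange H H') as (U & RU & E).
  exists (tcomp (effR C (deff (sc A B))) (tcomp U (prepR B Psi'))). split.
  { apply channel_comp; [apply channel_effR|].
    apply channel_comp; [apply RU|]. apply channel_prepR, H'. }
  apply mk_inj. rewrite mk_comp, mk_tens, !mk_comp, mk_effR, mk_prepR.
  replace (mk (tid A) @x _) with ((mid A @x (mid C @x mk (deff (sc A B)))) @o
    (mid A @x mk U) @o (mid A @x (mid B @x mk Psi'))).
  2:{ rewrite !mtensC by obj. now rewrite !mcomp1l by obj. }
  rewrite !mtensA, mtens11, mtens11, <- !mcompA.
  rewrite (mtens_states (A := sc A B) (f := mk Psi')) by obj. rewrite E, mtensC, mcomp1l by obj.
  rewrite <- mk_comp, (normalized_deff (proj1 (proj2 H))). apply mtens1r.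
Qed.

Lemma purification_swap (A B : Sys T) (Psi : Tr triv (sc B A)) :
  pure Psi -> normalized Psi -> purification (marg2 Psi) (tcomp (swap B A) Psi).
Proof.
  intros Pp Np. split; [apply pure_reversible; [apply reversible_swap|easy]|].
  split; [apply channel_normalized; [apply channel_swap|easy]|apply marg1_swap].
Qed.

Lemma swap_local (A B C : Sys T) (N : Tr B C) (Psi : Tr triv (sc B A)) :
  tcomp (ttens (tid A) N) (tcomp (swap B A) Psi) =
  tcomp (swap C A) (tcomp (ttens N (tid A)) Psi).
Proof.
  rewrite !(comp_assoc HT). f_equal. symmetry. apply (swap_nat HT).
Qed.

(** The mirror image, with the purified system on the right, where the reference and the environment
    stand in the dilated state. *)
Lemma purification_channel_l (A B C : Sys T)
    (Psi : Tr triv (sc B A)) (Psi' : Tr triv (sc C A)) :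
  pure Psi -> normalized Psi -> pure Psi' -> normalized Psi' ->
  marg2 Psi = marg2 Psi' ->
  exists N : Tr B C, channel N /\ tcomp (ttens N (tid A)) Psi = Psi'.
Proof.
  intros P1 N1 P2 N2 E.
  pose proof (purification_swap P1 N1) as H. pose proof (purification_swap P2 N2) as H'.
  rewrite <- E in H'. destruct (purification_channel H H') as (N & CN & K).
  exists N. split; [easy|]. rewrite swap_local in K.
  apply (f_equal (tcomp (swap A C))) in K.
  now rewrite !(comp_assoc HT (swap A C)), (swap_invol HT), !(comp_idl HT) in K.
Qed.

(** * Conditioned tests and steering *)

Lemma flat_map_nth_seq (X Y : Type) (f : X -> list Y) (d : X) (l : list X) :
  flat_map (fun i => f (nth i l d)) (seq 0 (length l)) = flat_map f l.
Proof.
  induction l as [|x l IH]; cbn; [easy|]. f_equal.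
  rewrite <- IH, <- seq_shift, !flat_map_concat_map, map_map. reflexivity.
Qed.

(** Conditioning with each outcome paired with its follow-up test, in place of a family indexed by
    position. *)
Lemma test_branch (A B C : Sys T) (ps : list (Tr A B * list (Tr B C))) :
  isTest (map fst ps) -> (forall p, In p ps -> isTest (snd p)) ->
  isTest (flat_map (fun p => map (fun d => tcomp d (fst p)) (snd p)) ps).
Proof.
  intros H K. rewrite <- (flat_map_nth_seq _ (tzero A B, [])).
  pose proof (@test_cond T HT A B C (map fst ps)
    (fun i => snd (nth i ps (tzero A B, []))) H) as Q.
  rewrite length_map in Q.
  replace (flat_map _ _) with (flat_map (fun i => map
    (fun d => tcomp d (nth i (map fst ps) (tzero A B))) (snd (nth i ps (tzero A B, []))))
    (seq 0 (length ps))).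
  - apply Q. intros i Hi. apply K, nth_In, Hi.
  - apply flat_map_ext. intros i.
    (* The default pair projects to the default [tzero A B] used by the conditioning axiom, so
       [map_nth] applies at every index. *)
    pose proof (map_nth fst ps (tzero A B, []) i) as E. cbn in E. now rewrite E.
Qed.

Lemma isTest_prepR (A B : Sys T) (phi : Tr triv B) :
  normalized phi -> isTest [prepR A phi].
Proof.
  intros H. pose proof (test_par HT (test_id HT A) (normalized_isTest H)) as K.
  cbn in K. unfold prepR. now destruct (sc_unitr A).
Qed.

Lemma prepR_state (A B : Sys T) (phi : Tr triv B) (rho : Tr triv A) :
  tcomp (prepR A phi) rho = pairst rho phi.
Proof. apply mk_inj. rewrite mk_comp, mk_prepR, mk_pairst. now apply mtens_states. Qed.

(* Flag the branch [D] of a decomposition of [rho] with perfectly distinguishable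
   states: a purification of the flagged state is reached from [Psi] by a channel on
   the purifying system, and reading the flag there selects [D]. *)
Lemma steering (A B : Sys T) (rho D : Tr triv A) (Psi : Tr triv (sc A B)) :
  normalized rho -> purification rho Psi -> refines D rho ->
  exists b : Tr B triv, phys b /\ tcomp (effR A b) Psi = D.
Proof.
  intros Nr HPsi HD. destruct (refines_normalized Nr HD) as (l & Hl & El).
  destruct (perf_dist HT) as (X & p0 & p1 & a0 & a1 & N0 & N1 & Ta & E00 & _ & E01 & _).
  set (s := tadd (pairst D p0) (pairst (tsum l) p1)).
  assert (Ns : normalized s).
  { set (ps := (D, [prepR A p0]) :: map (fun x => (x, [prepR A p1])) l).
    assert (Tp : isTest (flat_map (fun p => map (fun d => tcomp d (fst p)) (snd p)) ps)).
    { apply test_branch.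
      - unfold ps. cbn. now rewrite map_map, map_id.
      - intros p [<-|Hp]; [now apply isTest_prepR|].
        apply in_map_iff in Hp. destruct Hp as (x & <- & _). now apply isTest_prepR. }
    replace s with (tsum (flat_map (fun p => map (fun d => tcomp d (fst p)) (snd p)) ps)).
    { apply test_state_normalized.
      apply (test_tsum (f := tcomp (prepR A p0) D) Tp). now left. }
    unfold ps, s. rewrite <- !prepR_state, comp_tsumr. cbn. f_equal. unfold tsum.
    clear. induction l as [|x l IH]; cbn; [|rewrite IH]; easy. }
  assert (Es : forall b, tcomp (effR A b) s =
    tadd (tscal (prob (tcomp b p0)) D) (tscal (prob (tcomp b p1)) (tsum l))).
  { intros b. unfold s. now rewrite (comp_addr HT), !effR_pairst, !comp_scalar. }
  destruct (proj1 HP _ _ Ns) as (Y & Phi & Pp & Np & Mp).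
  assert (HPhi : purification rho (castT (eq_sym (sc_assoc A X Y)) Phi)).
  { split; [now apply pure_castT|]. split; [now apply normalized_castT|].
    rewrite <- El. cbn. fold (tsum l).
    (* The coefficients 1 are written as the total weights of the flags [p0] and [p1], which
       exhibits [rho] as the marginal of [s]. *)
    rewrite <- (scal_one HT D), <- (scal_one HT (tsum l)).
    rewrite <- (proj2 N0) at 1. rewrite <- (proj2 N1), <- Es, <- Mp.
    apply mk_inj. rewrite mk_marg1, mk_comp, mk_effR, mk_marg1, mk_castT, mk_deff_sc.
    rewrite mcompA, mtensA. f_equal.
    rewrite <- (mtens1r (mid A @x mk (deff X))) at 2. symmetry. apply mtens_slide; obj. }
  destruct (purification_channel HPsi HPhi) as (N & CN & EN).
  (* Map the purifying system [B] to [XY], discard [Y] and read the flag [X] with [a0]. *)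
  exists (tcomp a0 (tcomp (effR X (deff Y)) N)). split.
  { apply phys_comp; [apply (test_in_phys Ta); now left|].
    apply phys_comp; [apply channel_effR|apply CN]. }
  transitivity (tcomp (effR A a0) s).
  2:{ now rewrite Es, E00, E01, (scal_one HT), scal_zero, (add_zero HT). }
  apply (f_equal mk) in EN. rewrite mk_castT, mk_comp, mk_tens, mk_id in EN.
  rewrite <- Mp. apply mk_inj. rewrite !mk_comp, mk_effR, !mk_comp, mk_effR, mk_effR, mk_marg1.
  rewrite <- EN, !mcompA. f_equal.
  rewrite <- mtens11, <- (mtensA (mid A) (mid X)).
  rewrite !mtensC by obj. now rewrite !mcomp1l by obj.
Qed.

(** * Faithful states and reversible dilations *)

(** Non-determinism supplies a coin. Induction on the list: one face leads to a test containing the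
    new state, the others to the test built so far, and every earlier state is only rescaled. [rho]
    starts the induction. *)
Lemma covering_test (A : Sys T) (rho : Tr triv A) (ss : list (Tr triv A)) :
  normalized rho -> Forall (@phys T triv A) ss ->
  exists t : list (Tr triv A), isTest t /\ (exists x, In x t) /\
    forall s, In s ss -> exists c, c <> 0 /\ In (tscal c s) t.
Proof.
  intros Nr. induction ss as [|s ss IH]; intros Hs.
  - exists [rho]. split; [now apply normalized_isTest|]. split; [|easy].
    exists rho. now left.
  - inversion_clear Hs as [|? ? Ps Pss]. destruct (IH Pss) as (t & Ht & (x & Hx) & Ct).
    destruct (phys_test HT Ps) as (ls & Hls & Is).
    destruct (non_det HT) as (p & Pp & p0 & p1).
    destruct (phys_test HT Pp) as (lp & Hlp & Ip).
    destruct (in_split p lp Ip) as (u & v & ->).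
    apply (test_perm HT) with (l' := p :: u ++ v) in Hlp;
      [|symmetry; apply Permutation_middle].
    set (r := u ++ v) in *.
    (* Since [prob p] is below 1, another outcome [q] of the coin has nonzero probability; its
       branch keeps nonzero multiples of the earlier states. *)
    assert (Q : exists q, In q r /\ prob q <> 0).
    { pose proof (test_prob HT Hlp) as E. cbn in E.
      apply NNPP. intros Nq. enough (fold_right Rplus 0 (map prob r) = 0) by lra.
      clear - Nq. induction r as [|q r IH]; cbn; [easy|]. rewrite IH.
      - destruct (Req_dec (prob q) 0) as [->|n]; [lra|].
        destruct Nq. exists q. split; [now left|easy].
      - intros (q' & Hq & n). apply Nq. exists q'. split; [now right|easy]. }
    destruct Q as (q & Hq & nq).
    set (ps := (p, ls) :: map (fun q => (q, t)) r).
    exists (flat_map (fun p => map (fun d => tcomp d (fst p)) (snd p)) ps).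
    assert (I1 : In (tscal (prob p) s)
      (flat_map (fun p => map (fun d => tcomp d (fst p)) (snd p)) ps)).
    { apply in_flat_map. exists (p, ls). split; [now left|].
      rewrite <- comp_scalar. apply in_map_iff. eauto. }
    split; [|split; [eauto|]].
    + apply test_branch.
      * unfold ps. cbn. now rewrite map_map, map_id.
      * intros p' [<-|Hp]; [easy|].
        apply in_map_iff in Hp. destruct Hp as (y & <- & _). easy.
    + intros s' [<-|Hs'].
      * exists (prob p). split; [lra|easy].
      * destruct (Ct s' Hs') as (c & nc & Ic). exists (prob q * c). split.
        { now apply Rmult_integral_contrapositive. }
        apply in_flat_map. exists (q, t). split.
        { right. apply in_map_iff. eauto. }
        rewrite <- (scal_mul HT), <- comp_scalar. apply in_map_iff. eauto.
Qed.

Lemma eq_on_span (A B : Sys T) (f g : Tr A B) (l : list (Tr triv A)) (s : Tr triv A) :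
  (forall x, In x l -> tcomp f x = tcomp g x) -> in_span l s -> tcomp f s = tcomp g s.
Proof.
  intros H (cs & Hc & ->). rewrite !comp_tsumr, !map_map. f_equal.
  apply map_ext_in. intros [c x] Hx. apply in_combine_r in Hx. cbn.
  now rewrite !(comp_scalr HT), H.
Qed.

(** Take the sum of a test containing nonzero multiples of physical states that span the state
    space. Agreement on its refinements is agreement on a spanning set, which linearity extends to
    all states. *)
Lemma complete_state (A : Sys T) (rho : Tr triv A) :
  normalized rho -> exists omega : Tr triv A, normalized omega /\
    forall (B : Sys T) (f g : Tr A B),
      (forall D, refines D omega -> tcomp f D = tcomp g D) ->
      forall s : Tr triv A, tcomp f s = tcomp g s.
Proof.
  intros Nr. destruct (fin_dim_states HT A) as (basis & Hb).
  (* Basis vectors need not be physical, so each is replaced by finitely many physical states having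
     it in their span. *)
  assert (K : exists ss, Forall (@phys T triv A) ss /\
    forall s, In s basis -> exists l, incl l ss /\ in_span l s).
  { clear Hb. induction basis as [|b basis (ss & Fs & Hs)].
    - exists []. split; [easy|]. intros s [].
    - destruct (span_phys HT b) as (l & Fl & Hl). exists (l ++ ss). split.
      + now apply Forall_app.
      + intros s [<-|Hi].
        * exists l. split; [now apply incl_appl, incl_refl|easy].
        * destruct (Hs s Hi) as (l' & I & E). exists l'. split; [now apply incl_appr|easy]. }
  destruct K as (ss & Fs & Hs).
  destruct (covering_test Nr Fs) as (t & Ht & (x & Hx) & Ct).
  exists (tsum t). split; [apply test_state_normalized, (test_tsum Ht Hx)|].
  intros B f g H.
  assert (E : forall s, In s ss -> tcomp f s = tcomp g s).
  { intros s Is. destruct (Ct s Is) as (c & nc & Ic).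
    assert (R : refines (tscal c s) (tsum t)).
    { exists t, t, []. rewrite app_nil_r. repeat split; easy. }
    apply H in R. rewrite !(comp_scalr HT) in R.
    apply (f_equal (tscal (/ c))) in R.
    rewrite !(scal_mul HT), !Rinv_l, !(scal_one HT) in R by easy. exact R. }
  intros s. apply eq_on_span with basis; [|apply Hb]. intros y Hy.
  destruct (Hs y Hy) as (l & I & Hl). apply eq_on_span with l; [|easy]. auto.
Qed.

Lemma effR_local (A B S : Sys T) (b : Tr S triv) (h : Tr A B) (rho : Tr triv (sc A S)) :
  tcomp (effR B b) (tcomp (ttens h (tid S)) rho) = tcomp h (tcomp (effR A b) rho).
Proof.
  apply mk_inj. rewrite !mk_comp, !mk_effR, mk_tens, !mcompA. f_equal.
  rewrite mk_id, mtens_slide' by obj. rewrite <- (mtens1r (mk h)) at 2.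
  symmetry. now apply mtens_slide.
Qed.

(** Local discriminability removes the ancilla: conditioning on an effect of [S] reduces the
    comparison to states of [A] alone. *)
Lemma eq_of_states (A B : Sys T) (f g : Tr A B) :
  phys f -> phys g -> (forall s : Tr triv A, tcomp f s = tcomp g s) -> f = g.
Proof.
  intros Pf Pg H. apply (transf_sep HT). intros S rho Pr.
  apply local_ext.
  1,2: apply phys_comp; [apply phys_tens; [easy|apply phys_id]|easy].
  intros a b Ha Hb. now rewrite !effR_local, H.
Qed.

(** Purify a complete state. By steering, effects on [S] produce all its refinements, so agreement
    on [Psi] gives agreement on each of them. *)
Lemma faithful_state (A : Sys T) (rho : Tr triv A) :
  normalized rho -> exists (S : Sys T) (Psi : Tr triv (sc A S)),
    pure Psi /\ normalized Psi /\
    forall (B : Sys T) (f g : Tr A B), phys f -> phys g ->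
      tcomp (ttens f (tid S)) Psi = tcomp (ttens g (tid S)) Psi -> f = g.
Proof.
  intros Nr. destruct (complete_state Nr) as (omega & No & Ho).
  destruct (proj1 HP _ _ No) as (S & Psi & HPsi). exists S, Psi.
  split; [apply HPsi|]. split; [apply HPsi|]. intros B f g Pf Pg E.
  apply eq_of_states; [easy..|]. apply Ho. intros D HD.
  destruct (steering No HPsi HD) as (b & _ & <-). now rewrite <- !effR_local, E.
Qed.

(* A purification [Phi] of the Choi state of [C] is the ancilla, and the dilating
   reversible channel is the exchange of [Phi] with the faithful state. *)
Lemma channel_dilation (A B : Sys T) (rho : Tr triv A) (C : Tr A B) :
  normalized rho -> channel C ->
  exists (E : Sys T) (V : Tr A (sc B E)), rev_dilation C V.
Proof.
  intros Nr CC. destruct (faithful_state Nr) as (S & Psi & Pp & Np & Ff).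
  pose proof (purification_swap Pp Np) as H.
  set (Psi' := tcomp (swap A S) Psi) in *.
  set (Choi := tcomp (ttens (tid S) C) Psi').
  assert (NC : normalized Choi).
  { apply channel_normalized; [|apply H]. apply channel_tens; [apply channel_id|easy]. }
  destruct (proj1 HP _ _ NC) as (E & Phi & PPhi & NPhi & MPhi).
  set (Phi' := castT (eq_sym (sc_assoc S B E)) Phi).
  assert (PPhi' : pure Phi') by now apply pure_castT.
  assert (NPhi' : normalized Phi') by now apply normalized_castT.
  (* The channel [C] does not touch the marginal on [S], so [Phi], regrouped with purifying system
     [BE], and [Psi'] purify the same state. *)
  assert (H' : purification (marg2 Psi) Phi').
  { split; [easy|]. split; [easy|].
    destruct H as (_ & _ & <-). rewrite <- (marg1_local (N := C) Psi') by easy.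
    fold Choi. rewrite <- MPhi. apply mk_inj. rewrite !mk_marg1. unfold Phi'.
    rewrite mk_castT, mk_deff_sc, mcompA, mtensA. f_equal.
    rewrite <- (mtens1r (mid S @x mk (deff B))) at 2. symmetry. apply mtens_slide; obj. }
  destruct (purification_exchange H H') as (U & RU & EU).
  assert (e : sc (sc B E) (sc S A) = sc B (sc E (sc S A))) by (now rewrite !sc_assoc).
  (* The environment consists of [E] and of the systems [S] and [A] carrying the copy of [Psi'] left
     over by the exchange. *)
  set (V := tcomp (castT e U) (prepR A Phi')).
  assert (CV : channel V).
  { apply channel_comp; [apply channel_castT, RU|now apply channel_prepR]. }
  exists (sc E (sc S A)), V. split; [easy|]. split.
  2:{ exists (sc S (sc B E)), Phi', (castT e U). split; [easy|]. split; [|easy].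
    now apply reversible_castT. }
  apply Ff; [|apply CC|].
  { apply phys_castT, phys_comp; [apply phys_tens; [apply phys_id|apply phys_deff]|apply CV]. }
  (* [G] stands for the marginal of [V], known only through its bundle, which keeps the transports
     out of the computation. *)
  enough (K : forall G : Tr A B, mk G = (mid B @x mk (deff (sc E (sc S A)))) @o mk V ->
    tcomp (swap B S) (tcomp (ttens G (tid S)) Psi) = Choi).
  { assert (I : forall x y : Tr triv (sc B S), tcomp (swap B S) x = tcomp (swap B S) y -> x = y).
    { intros x y Exy. apply (f_equal (tcomp (swap S B))) in Exy.
      now rewrite !(comp_assoc HT), (swap_invol HT), !(comp_idl HT) in Exy. }
    apply I. rewrite K.
    - unfold Choi, Psi'. now rewrite swap_local.
    - now rewrite mk_castT, mk_comp, mk_tens, mk_id. }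
  intros G EG. rewrite <- swap_local. fold Psi'. rewrite <- MPhi.
  apply mk_inj. rewrite mk_marg1, mk_comp, mk_tens, mk_id, EG.
  unfold V. rewrite mk_comp, mk_castT, mk_prepR.
  replace (mid S @x _) with ((mid S @x (mid B @x mk (deff (sc E (sc S A))))) @o
    (mid S @x mk U) @o (mid S @x (mid A @x mk Phi'))).
  2:{ rewrite !mtensC by obj. now rewrite !mcomp1l by obj. }
  rewrite <- !mcompA, (mtensA (mid S) (mid A)), (mtens11 S A).
  (* The prepared state is now [Psi'] beside [Phi'], which [U] exchanges; discarding [Psi'] and [E]
     leaves the Choi state. *)
  rewrite (mtens_states (A := sc S A) (f := mk Phi')) by obj.
  rewrite EU, mk_deff_sc, !mtensA, mtens11, mtensC by obj.
  rewrite <- (mk_comp _ Psi'), (normalized_deff (proj1 (proj2 H))).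
  unfold Phi'. rewrite mk_castT. apply mtens1r.
Qed.

(** The dilation equation in context, with a further map [G] on the output and a spectator [S]. *)
Lemma dilation_marginal (A B E S D : Sys T) (C : Tr A B) (V : Tr A (sc B E)) (G : Tr B D) :
  rev_dilation C V ->
  (mk G @x (mk (deff E) @x mid S)) @o (mk V @x mid S) = mk (tcomp G C) @x mid S.
Proof.
  intros (_ & <- & _). rewrite mtensA, mtensC, mcomp1l by obj. f_equal.
  rewrite mk_comp, mk_castT, mk_comp, mk_tens, mk_id, mcompA. f_equal.
  rewrite <- (mtens1r (mk G)) at 2. symmetry. now apply mtens_slide.
Qed.

Lemma mswap_deff (A B : Sys T) :
  (mk (deff A) @x mid B) @o mswap B A = mid B @x mk (deff A).
Proof.
  rewrite <- (mswap_nat (B := B) (D := triv)) by obj. rewrite mswap1. apply mcomp1l. obj.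
Qed.

Lemma mswap_deff' (A B : Sys T) :
  (mid B @x mk (deff A)) @o mswap A B = mk (deff A) @x mid B.
Proof.
  rewrite <- (mswap_nat (B := triv) (D := B)) by obj. rewrite mswap1'. apply mcomp1l. obj.
Qed.

(** Up to reversible maps the dilated state is [Psi] beside the pure ancilla [phi]. *)
Lemma rev_dilation_pure (A B E S : Sys T) (C : Tr A B) (V : Tr A (sc B E))
    (Psi : Tr triv (sc A S)) :
  rev_dilation C V -> pure Psi -> normalized Psi ->
  pure (tcomp (ttens V (tid S)) Psi).
Proof.
  intros (CV & _ & E0 & phi & U & Pphi & RU & ->) Pp Np. fold (prepR A phi) in *.
  (* Purity does not include normalization: the weight of [phi] is read off from [V] and [U] being
     channels, with the marginal of [Psi] as input. *)
  assert (Nphi : normalized phi).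
  { split; [apply Pphi|]. set (r := marg1 Psi).
    assert (Nr : normalized r) by now apply normalized_marg1.
    pose proof (channel_normalized CV Nr) as [_ K].
    rewrite !(comp_assoc HT), (proj2 (proj1 RU)), <- (comp_assoc HT) in K.
    rewrite prepR_state, <- deff_effL, <- (comp_assoc HT), effL_pairst in K.
    now rewrite (normalized_deff Nr), (comp_idr HT) in K. }
  assert (e : sc (sc A S) E0 = sc A (sc S E0)) by (now rewrite sc_assoc).
  assert (e' : sc A (sc E0 S) = sc (sc A E0) S) by (now rewrite sc_assoc).
  (* The ancilla is prepared behind [S] and then swapped past it to stand next to [A], where [U]
     acts. *)
  replace (tcomp (ttens (tcomp U (prepR A phi)) (tid S)) Psi) with
    (tcomp (ttens U (tid S)) (castT e' (tcomp (ttens (tid A) (swap S E0))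
      (castT e (pairst Psi phi))))).
  { apply pure_reversible; [apply reversible_tens; [easy|apply reversible_id]|].
    apply pure_castT, pure_reversible.
    - apply reversible_tens; [apply reversible_id|apply reversible_swap].
    - now apply pure_castT, pure_pairst. }
  apply mk_inj. rewrite !mk_comp, !mk_tens, !mk_castT, mk_comp, mk_castT, mk_tens.
  rewrite mk_comp, mk_prepR, mk_pairst, !mk_id.
  replace ((mk U @o _) @x mid S) with ((mk U @x mid S) @o (mid A @x mk phi @x mid S))
    by (rewrite mtensC, mcomp1l by obj; easy).
  rewrite <- mcompA. f_equal. rewrite <- (mtens_states (A := sc A S) (f := mk phi) (g := mk Psi)) by obj.
  rewrite mcompA. f_equal. change (mk (swap S E0)) with (mswap S E0).
  rewrite <- mtens11, <- !mtensA, mtensC, mcomp1l by obj. f_equal.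
  rewrite (mswap_nat (A := S) (C := triv)) by obj. rewrite mswap1. apply mcomp1r. obj.
Qed.

(** * Correctability and decoupling from the environment *)

(** Effects on [S] condition [Psi] to refinements of [rho], and by steering to all of them. Local
    discriminability then gives the forward implication, steering the converse. *)
Lemma correctable_iff_local (A B S : Sys T) (rho : Tr triv A) (C : Tr A B) (Psi : Tr triv (sc A S)) :
  normalized rho -> channel C -> purification rho Psi ->
  (correctable C rho <-> exists Rc : Tr B A, channel Rc /\
     tcomp (ttens (tcomp Rc C) (tid S)) Psi = Psi).
Proof.
  intros Nr CC HPsi. split; intros (Rc & CR & H); exists Rc; (split; [easy|]).
  - apply local_ext; [|apply HPsi|].
    { apply phys_comp; [|apply HPsi]. apply phys_tens; [|apply phys_id].
      apply phys_comp; [apply CR|apply CC]. }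
    intros a b Ha Hb. rewrite effR_local, <- (comp_assoc HT), H; [easy|].
    destruct HPsi as (PP & _ & <-). apply refines_effR; [|easy]. apply refines_refl, PP.
  - intros D HD. destruct (steering Nr HPsi HD) as (b & _ & <-).
    now rewrite (comp_assoc HT), <- effR_local, H.
Qed.

Lemma correctable_imp_uncorrelated (A B : Sys T) (rho : Tr triv A) (C : Tr A B) :
  normalized rho -> channel C -> correctable C rho ->
  exists (E S : Sys T) (V : Tr A (sc B E)) (Psi : Tr triv (sc A S)) (sigma : Tr triv E),
    rev_dilation C V /\ purification rho Psi /\ normalized sigma /\
    (mk (deff B) @x mid E @x mid S) @o (mk V @x mid S) @o mk Psi =
      mk sigma @x mk (marg2 Psi).
Proof.
  intros Nr CC Cor. destruct (proj1 HP _ _ Nr) as (S & Psi & HPsi).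
  destruct (channel_dilation Nr CC) as (E & V & HV).
  apply (correctable_iff_local Nr CC HPsi) in Cor. destruct Cor as (Rc & CR & HR).
  set (W := castT (eq_sym (sc_assoc B E S)) (tcomp (ttens V (tid S)) Psi)).
  (* After recovery on [B], the environment is swapped past the reference, so that the first
     marginal of [tau] lives on [AS]. *)
  set (tau := castT (sc_assoc A S E) (tcomp (ttens Rc (swap E S)) W)).
  assert (Nt : normalized tau).
  { apply normalized_castT, channel_normalized.
    - apply channel_tens; [easy|apply channel_swap].
    - apply normalized_castT, channel_normalized; [|apply HPsi].
      apply channel_tens; [apply HV|apply channel_id]. }
  assert (Et : mk tau = (mk Rc @x mswap E S) @o (mk V @x mid S) @o mk Psi).
  { unfold tau, W. now rewrite mk_castT, mk_comp, mk_tens, mk_castT, mk_comp, mk_tens. }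
  assert (M1 : marg1 tau = Psi).
  { apply mk_inj. rewrite mk_marg1, Et. apply (f_equal mk) in HR.
    rewrite mk_comp, mk_tens, mk_id, <- (dilation_marginal S Rc HV) in HR.
    rewrite <- HR at 2. rewrite !mcompA. do 2 f_equal.
    rewrite <- (mswap_deff' E S), <- mtens11, <- mtensA, mtensC, mcomp1l by obj. easy. }
  exists E, S, V, Psi, (marg2 tau).
  split; [easy|]. split; [easy|]. split; [now apply normalized_marg2|].
  pose proof (pure_marginal_product Nt) as P. rewrite M1 in P.
  specialize (P (proj2 (proj1 HPsi))).
  apply (f_equal mk) in P. rewrite Et, mk_pairst in P.
  set (sg := mk (marg2 tau)) in *.
  (* Discard [A] and restore the order of [E] and [S]. On the left [Rc] is absorbed, since
     discarding after a channel is discarding its input. *)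
  apply (f_equal (fun f => mswap S E @o (mk (deff A) @x mid S @x mid E) @o f)) in P.
  rewrite (mtensC (f := mk (deff A) @x mid S)), mcomp1l, <- mk_marg2 in P by obj.
  rewrite (mswap_nat (A := triv) (C := triv)), mswap1, mcomp1r in P by obj.
  rewrite <- P, !mcompA. do 2 f_equal.
  rewrite <- mcompA, <- (mtensA (mk (deff A))), mtensC by obj.
  rewrite mtens11, (mcomp1l (f := mswap E S)), <- mk_comp, (proj2 CR) by obj.
  rewrite <- (mtens1l (mswap S E)), mtensC, mswapK, mcomp1l by obj.
  now rewrite <- mtensA, mtens11.
Qed.

Lemma uncorrelated_imp_correctable (A B E S : Sys T) (rho : Tr triv A) (C : Tr A B)
    (V : Tr A (sc B E)) (Psi : Tr triv (sc A S)) (sigma : Tr triv E) :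
  normalized rho -> channel C -> rev_dilation C V -> purification rho Psi ->
  normalized sigma ->
  (mk (deff B) @x mid E @x mid S) @o (mk V @x mid S) @o mk Psi =
    mk sigma @x mk (marg2 Psi) ->
  correctable C rho.
Proof.
  intros Nr CC HV HPsi Ns H. apply (correctable_iff_local Nr CC HPsi).
  destruct HPsi as (PP & NP & _).
  destruct (proj1 HP _ _ Ns) as (F & Sig & HS).
  set (Sig' := tcomp (swap E F) Sig).
  assert (PS : pure Sig') by (apply pure_reversible; [apply reversible_swap|apply HS]).
  assert (NS : normalized Sig') by (apply channel_normalized; [apply channel_swap|apply HS]).
  assert (MS : marg2 Sig' = sigma).
  { destruct HS as (_ & _ & <-). unfold Sig'. rewrite <- marg1_swap.
    now rewrite (comp_assoc HT), (swap_invol HT), (comp_idl HT). }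
  set (W := castT (eq_sym (sc_assoc B E S)) (tcomp (ttens V (tid S)) Psi)).
  assert (e1 : sc (sc F E) (sc A S) = sc F (sc (sc E A) S)) by (now rewrite !sc_assoc).
  assert (e2 : sc F (sc (sc A E) S) = sc (sc F A) (sc E S)) by (now rewrite !sc_assoc).
  (* The product of [Sig'] and [Psi] regrouped as [(FA)(ES)], so that it purifies on the left the
     state of [ES]. *)
  set (W' := castT e2 (tcomp (ttens (tid F) (ttens (swap E A) (tid S)))
    (castT e1 (pairst Sig' Psi)))).
  assert (EW : mk W = (mk V @x mid S) @o mk Psi).
  { unfold W. now rewrite mk_castT, mk_comp, mk_tens. }
  assert (EW' : mk W' = (mid F @x (mswap E A @x mid S)) @o (mk Sig' @x mk Psi)).
  { unfold W'. now rewrite mk_castT, mk_comp, !mk_tens, mk_castT, mk_pairst. }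
  assert (R : reversible (ttens (tid F) (ttens (swap E A) (tid S)))).
  { repeat (apply reversible_tens || apply reversible_id || apply reversible_swap). }
  destruct (@purification_channel_l (sc E S) B (sc F A) W W') as (N & CN & EN).
  { apply pure_castT. now apply rev_dilation_pure with C. }
  { apply normalized_castT, channel_normalized; [|easy].
    apply channel_tens; [apply HV|apply channel_id]. }
  { apply pure_castT, pure_reversible; [easy|]. now apply pure_castT, pure_pairst. }
  { apply normalized_castT, channel_normalized; [apply R|].
    now apply normalized_castT, normalized_pairst. }
  (* The marginal of [W] on [ES] is a product by hypothesis; that of [W'] is the same product by
     construction. *)
  { apply mk_inj. rewrite !mk_marg2, EW, EW', <- mtens11, mtensA, H, <- MS.
    rewrite mcompA, mk_deff_sc, <- !(mtensA (mk (deff F))).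
    rewrite mtensC, mcomp1r by obj.
    rewrite (mtensA (mk (deff A))), (mtensC (g := mswap E A)), mswap_deff, mcomp1l by obj.
    rewrite <- (mtensA (mid E)), mtensA, mtensC by obj. now rewrite <- !mk_marg2. }
  (* The recovery applies the channel [N] from [B] to [FA] and discards [F]. *)
  exists (tcomp (effL A (deff F)) N). split; [apply channel_comp; [apply channel_effL|easy]|].
  apply mk_inj. rewrite mk_comp, mk_tens, mk_id.
  rewrite <- (dilation_marginal S _ HV), <- mcompA, <- EW.
  apply (f_equal mk) in EN. rewrite mk_comp, mk_tens, mk_id in EN.
  (* Discarding [F] and [E] turns the left side into recovery after [C] on [Psi], and removes [Sig']
     from the right side. *)
  apply (f_equal (mcomp ((mk (deff F) @x mid A) @x (mk (deff E) @x mid S)))) in EN.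
  rewrite EW', !mcompA, mtensC, mcomp1r in EN by obj.
  rewrite mk_comp, mk_effL, EN, <- (mtensA (mk (deff F)) (mid A)), mtensC, mcomp1r by obj.
  rewrite (mtensA (mid A)), (mtensC (g := mswap E A)), mswap_deff', mcomp1l by obj.
  rewrite <- (mtensA (mk (deff E))), mtensA, mtens11, mtensC, mcomp1l by obj.
  rewrite <- mk_deff_sc, <- mk_comp, (normalized_deff NS). apply mtens1l.
Qed.

End Theory.

Theorem mainTheorem16 (T : OPTdata) (HT : OPTaxioms T) (HP : PurificationPostulate T)
  (A B : Sys T) (rho : Tr triv A) (C : Tr A B) :
  normalized rho -> channel C ->
  (correctable C rho <->
   exists (E Rs : Sys T) (V : Tr A (sc B E)) (Psi : Tr triv (sc A Rs))
          (sigma : Tr triv E),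
     rev_dilation C V /\ purification rho Psi /\ normalized sigma /\
     castT (f_equal (fun X => sc X Rs) (sc_unitl E))
       (tcomp (ttens (ttens (deff B) (tid E)) (tid Rs)) (tcomp (ttens V (tid Rs)) Psi))
     = castS (sc_unitl triv) (ttens sigma (marg2 Psi))).
Proof.
  intros Nr CC. split.
  - intros Cor.
    destruct (correctable_imp_uncorrelated HT HP Nr CC Cor)
      as (E & S & V & Psi & sigma & HV & HPsi & Ns & H).
    exists E, S, V, Psi, sigma. split; [easy|]. split; [easy|]. split; [easy|].
    (* Bundling erases the transports and leaves the untyped decoupling equation. *)
    apply mk_inj. rewrite mk_castT, mk_castS, !mk_comp, !mk_tens, !mk_id. exact H.
  - intros (E & S & V & Psi & sigma & HV & HPsi & Ns & H).
    apply (uncorrelated_imp_correctable HT HP Nr CC HV HPsi Ns).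
    apply (f_equal mk) in H.
    rewrite mk_castT, mk_castS, !mk_comp, !mk_tens, !mk_id in H. exact H.
Qed.
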